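(* Let $M$ be a matroid. For any field $k$, the algebra $S_k(M)$ is a Reedy algebra, and so it is quasi-hereditary with a triangular decomposition.
   Context: $M$ is a matroid on a finite ground set with lattice of flats $\mathcal L$ ordered by inclusion and rank function $\rho$. For flats write $K\lessdot L$ (or $L\gtrdot K$) if $L$ covers $K$. A flag path is a finite nonempty sequence $(K_1,\dots,K_l)$ of flats with $K_i\lessdot K_{i+1}$ or $K_i\gtrdot K_{i+1}$ for each $i<l$ (commas may be replaced by these symbols). The free $\mathbb Z$-module on flag paths is an algebra under concatenation: $(K_1,\dots,K_l)\cdot(L_1,\dots,L_{l'})=(K_1,\dots,K_l=L_1,L_2,\dots,L_{l'})$ if $K_l=L_1$ and $0$ otherwise. $S(M)$ is its quotient by the two-sided ideal generated by: (FS) for flats $L<K$ with $\rho(K)=\rho(L)+2$: $\sum_X(L\lessdot X\lessdot K)=0=\sum_X(K\gtrdot X\gtrdot L)$, sums over flats $X$ with $K\gtrdot X\gtrdot L$; ($\bigwedge$) for $K\lessdot L$ and $K'\lessdot L$: $(K\lessdot L\gtrdot K')$ equals $|L\setminus K|\,(K)$ if $K=K'$; $-(K\gtrdot K\cap K'\lessdot K')$ if $K\ne K'$ and $K\cap K'\lessdot K$; and $0$ otherwise. $S_k(M)=S(M)\otimes_{\mathbb Z}k$, equipped with the complete set of pairwise orthogonal idempotents $\{(F):F\in\mathcal L\}$. Reedy algebra: let $A$ be a finite-dimensional $k$-algebra with a complete set $\mathcal E$ of pairwise orthogonal idempotents. $A$ is a Reedy algebra if there are a degree function $\deg:\mathcal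 E\to\mathbb N$ and two subalgebras $A^+,A^-$ (with the same unit as $A$) such that: (1) for all $e\in\mathcal E$, $eA^+e\cong k$ as $k$-vector spaces, and for $e_i\neq e_j$ in $\mathcal E$, $e_jA^+e_i\ne0$ implies $\deg(e_j)>\deg(e_i)$; (2) for all $e\in\mathcal E$, $eA^-e\cong k$ as $k$-vector spaces, and for $e_i\ne e_j$ in $\mathcal E$, $e_jA^-e_i\neq0$ implies $\deg(e_j)<\deg(e_i)$; (3) for any $e_i,e_j\in\mathcal E$, multiplication in $A$ induces an isomorphism of $k$-vector spaces $\bigoplus_{e_l\in\mathcal E}e_jA^+e_l\otimes_k e_lA^-e_i\to e_jAe_i$. The triangular decomposition referred to in the claim is the decomposition in (3). *)

(* Defs.v *)
From HB Require Import structures.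
From mathcomp Require Import all_boot all_algebra.
From mathcomp Require Import finmap boolp monalg.

Set Implicit Arguments.
Unset Strict Implicit.
Unset Printing Implicit Defensive.

Import GRing.Theory.
Local Open Scope ring_scope.
Local Open Scope quotient_scope.

(** * Submodules, ideals and quotients *)

Section Subspace.
Variables (R : pzRingType) (V : lmodType R) (U : submodClosed V).

Record subspace := Subspace { subspace_val :> V; _ : subspace_val \in U }.

HB.instance Definition _ := [isSub for subspace_val].
HB.instance Definition _ := [Choice of subspace by <:].
HB.instance Definition _ := [SubChoice_isSubLmodule of subspace by <:].

End Subspace.

Section GeneratedSubmodule.
Variables (R : pzRingType) (V : lmodType R) (G : V -> Prop).

Definition gen_submod : {pred V} :=
  [pred x | `[< forall U : submodClosed V,
                  (forall g, G g -> g \in U) -> x \in U >]].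

Lemma gen_submod_closed : submod_closed gen_submod.
Proof.
split; first by apply/asboolP => U _; apply: rpred0.
move=> a x y /asboolP xG /asboolP yG; apply/asboolP => U GU.
by rewrite rpredD ?rpredZ ?xG ?yG.
Qed.

HB.instance Definition _ :=
  GRing.isSubmodClosed.Build R V gen_submod gen_submod_closed.

Lemma mem_gen_submod g : G g -> g \in gen_submod.
Proof. by move=> Gg; apply/asboolP => U; apply. Qed.

Lemma gen_submod_min (U : submodClosed V) :
  (forall g, G g -> g \in U) -> {subset gen_submod <= U}.
Proof. by move=> GU x /asboolP; apply. Qed.

End GeneratedSubmodule.

Section ModuleQuotient.
Variables (R : pzRingType) (V : lmodType R) (U : submodClosed V).

Let U_zmod_closed : zmod_closed U.
Proof. by split=> [|x y xU yU]; rewrite ?rpred0 // -scaleN1r rpredD ?rpredZ. Qed.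

Definition additive_part : {pred V} := U.
HB.instance Definition _ := GRing.isZmodClosed.Build V additive_part U_zmod_closed.

Definition mquot : Type := Quotient.quot additive_part.
HB.instance Definition _ := GRing.Zmodule.on mquot.

Definition mpi (x : V) : mquot := \pi_(Quotient.quot additive_part) x.

Lemma mpi_eqE x y : (mpi x = mpi y) <-> (x - y \in U).
Proof.
rewrite -[x - y \in U]/(x - y \in additive_part).
by rewrite Quotient.idealrBE; split => [/eqP|/eqP].
Qed.

Lemma mpi_surj (x : mquot) : exists y, x = mpi y.
Proof. by exists (repr (x : Quotient.quot additive_part)); rewrite /mpi reprK. Qed.

Lemma mpi_is_zmod_morphism : zmod_morphism mpi.
Proof. by move=> x y; rewrite /mpi raddfB. Qed.
HB.instance Definition _ := GRing.isZmodMorphism.Build V mquot mpi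
  mpi_is_zmod_morphism.

Definition mquot_scale (a : R) (x : mquot) : mquot :=
  mpi (a *: repr (x : Quotient.quot additive_part)).

Lemma mpiZ a x : mquot_scale a (mpi x) = mpi (a *: x).
Proof.
apply/mpi_eqE; rewrite -scalerBr rpredZ //; apply/mpi_eqE.
by rewrite /mpi reprK.
Qed.

Lemma mquot_scalerA a b x :
  mquot_scale a (mquot_scale b x) = mquot_scale (a * b) x.
Proof. by have [y ->] := mpi_surj x; rewrite !mpiZ scalerA. Qed.

Lemma mquot_scale1r : left_id 1 mquot_scale.
Proof. by move=> x; have [y ->] := mpi_surj x; rewrite mpiZ scale1r. Qed.

Lemma mquot_scalerDr : right_distributive mquot_scale +%R.
Proof.
move=> a x y; have [x' ->] := mpi_surj x; have [y' ->] := mpi_surj y.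
by rewrite -raddfD !mpiZ -raddfD scalerDr.
Qed.

Lemma mquot_scalerDl x : {morph mquot_scale^~ x : a b / a + b}.
Proof.
by move=> a b; have [y ->] := mpi_surj x; rewrite !mpiZ -raddfD scalerDl.
Qed.

HB.instance Definition _ := GRing.Zmodule_isLmodule.Build R mquot
  mquot_scalerA mquot_scale1r mquot_scalerDr mquot_scalerDl.

Lemma mpi_is_scalable : scalable mpi.
Proof. by move=> a x; rewrite -mpiZ. Qed.
HB.instance Definition _ := GRing.isScalable.Build R V mquot *:%R mpi
  mpi_is_scalable.

End ModuleQuotient.

Definition two_sided (R : pzRingType) (S : {pred R}) : Prop :=
  forall a x, x \in S -> (a * x \in S) /\ (x * a \in S).

HB.mixin Record isTwoSided (R : pzRingType) (S : R -> bool) := {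
  two_sided_subproof : two_sided S
}.

(* Two-sided ideals; unlike [idealr] they may contain 1. *)
#[short(type="tideal")]
HB.structure Definition TIdeal (R : pzRingType) :=
  {S of GRing.ZmodClosed R S & isTwoSided R S}.

Section TIdealTheory.
Variables (R : pzRingType) (J : tideal R).

Lemma tidealMl a x : x \in J -> a * x \in J.
Proof. by move=> xJ; have [] := @two_sided_subproof R J a x xJ. Qed.

Lemma tidealMr a x : x \in J -> x * a \in J.
Proof. by move=> xJ; have [] := @two_sided_subproof R J a x xJ. Qed.

(* A two-sided ideal as a submodule of the left regular module. *)
Definition left_regular : {pred R^o} := fun x => x \in J.

Lemma left_regular_closed : submod_closed left_regular.
Proof.
split; first exact: (rpred0 J).
by move=> a x y xJ yJ; apply: rpredD (tidealMl _ _) _.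
Qed.

HB.instance Definition _ :=
  GRing.isSubmodClosed.Build R R^o left_regular left_regular_closed.

End TIdealTheory.

Section GeneratedIdeal.
Variables (R : pzRingType) (G : R -> Prop).

Definition gen_ideal : {pred R} :=
  [pred x | `[< forall J : tideal R,
                  (forall g, G g -> g \in J) -> x \in J >]].

Lemma gen_ideal_zmod : zmod_closed gen_ideal.
Proof.
split; first by apply/asboolP => J _; apply: rpred0.
move=> x y /asboolP xG /asboolP yG; apply/asboolP => J GJ.
by rewrite rpredB ?xG ?yG.
Qed.

Lemma gen_ideal_two_sided : two_sided gen_ideal.
Proof.
move=> a x /asboolP xG; split; apply/asboolP => J GJ.
  by apply: tidealMl; apply: xG.
by apply: tidealMr; apply: xG.
Qed.

HB.instance Definition _ := GRing.isZmodClosed.Build R gen_ideal gen_ideal_zmod.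
HB.instance Definition _ := isTwoSided.Build R gen_ideal gen_ideal_two_sided.

Lemma mem_gen_ideal g : G g -> g \in gen_ideal.
Proof. by move=> Gg; apply/asboolP => J; apply. Qed.

Lemma gen_ideal_min (J : tideal R) :
  (forall g, G g -> g \in J) -> {subset gen_ideal <= J}.
Proof. by move=> GJ x /asboolP; apply. Qed.

End GeneratedIdeal.

Section RingQuotient.
Variables (R : pzRingType) (J : tideal R).

Definition rquot : Type := Quotient.quot J.
HB.instance Definition _ := GRing.Zmodule.on rquot.

Definition rpi (x : R) : rquot := \pi_(Quotient.quot J) x.

Lemma rpi_eqE x y : (rpi x = rpi y) <-> (x - y \in J).
Proof. by rewrite Quotient.idealrBE; split => [/eqP|/eqP]. Qed.

Lemma rpi_surj (x : rquot) : exists y, x = rpi y.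
Proof. by exists (repr (x : Quotient.quot J)); rewrite /rpi reprK. Qed.

Lemma rpi_is_zmod_morphism : zmod_morphism rpi.
Proof. by move=> x y; rewrite /rpi raddfB. Qed.
HB.instance Definition _ := GRing.isZmodMorphism.Build R rquot rpi
  rpi_is_zmod_morphism.

Definition rquot_mul (x y : rquot) : rquot :=
  rpi (repr (x : Quotient.quot J) * repr (y : Quotient.quot J)).

Lemma rpiM x y : rquot_mul (rpi x) (rpi y) = rpi (x * y).
Proof.
have reprP z : repr (rpi z : Quotient.quot J) - z \in J.
  by apply/rpi_eqE; rewrite /rpi reprK.
apply/rpi_eqE; set x' := repr _; set y' := repr _.
rewrite -[x' * y'](subrK (x' * y)) -mulrBr -addrA -mulrBl.
by apply: rpredD; [apply/tidealMl/reprP | apply/tidealMr/reprP].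
Qed.

Lemma rquot_mulA : associative rquot_mul.
Proof.
move=> x y z; have [x' ->] := rpi_surj x; have [y' ->] := rpi_surj y.
by have [z' ->] := rpi_surj z; rewrite !rpiM mulrA.
Qed.

Lemma rquot_mul1 : left_id (rpi 1) rquot_mul.
Proof. by move=> x; have [y ->] := rpi_surj x; rewrite rpiM mul1r. Qed.

Lemma rquot_mulr1 : right_id (rpi 1) rquot_mul.
Proof. by move=> x; have [y ->] := rpi_surj x; rewrite rpiM mulr1. Qed.

Lemma rquot_mulDl : left_distributive rquot_mul +%R.
Proof.
move=> x y z; have [x' ->] := rpi_surj x; have [y' ->] := rpi_surj y.
by have [z' ->] := rpi_surj z; rewrite -raddfD !rpiM -raddfD mulrDl.
Qed.

Lemma rquot_mulDr : right_distributive rquot_mul +%R.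
Proof.
move=> x y z; have [x' ->] := rpi_surj x; have [y' ->] := rpi_surj y.
by have [z' ->] := rpi_surj z; rewrite -raddfD !rpiM -raddfD mulrDr.
Qed.

HB.instance Definition _ := GRing.Zmodule_isPzRing.Build rquot
  rquot_mulA rquot_mul1 rquot_mulr1 rquot_mulDl rquot_mulDr.

Lemma rpi_is_monoid_morphism : monoid_morphism rpi.
Proof. by split=> // x y; rewrite -rpiM. Qed.
HB.instance Definition _ := GRing.isMonoidMorphism.Build R rquot rpi
  rpi_is_monoid_morphism.

(* The image of an ideal; it is [J' / J] when [J] is included in [J']. *)
Definition ideal_image (J' : {pred R}) : {pred rquot} :=
  [pred x | `[< exists2 y, y \in J' & x = rpi y >]].

Section Image.
Variable J' : tideal R.

Lemma ideal_image_zmod : zmod_closed (ideal_image J').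
Proof.
split; first by apply/asboolP; exists 0; rewrite ?rpred0 ?raddf0.
move=> _ _ /asboolP[x xJ ->] /asboolP[y yJ ->]; apply/asboolP.
by exists (x - y); rewrite ?rpredB ?raddfB.
Qed.

Lemma ideal_image_two_sided : two_sided (ideal_image J').
Proof.
move=> a _ /asboolP[x xJ ->]; have [b ->] := rpi_surj a.
split; apply/asboolP; first by exists (b * x); rewrite ?tidealMl ?rmorphM.
by exists (x * b); rewrite ?tidealMr ?rmorphM.
Qed.

HB.instance Definition _ :=
  GRing.isZmodClosed.Build rquot (ideal_image J') ideal_image_zmod.
HB.instance Definition _ :=
  isTwoSided.Build rquot (ideal_image J') ideal_image_two_sided.
End Image.

End RingQuotient.

(** * Linear extension from the basis of a free module *)

(* [free_lift], [tpure] and [tensor_lift] are locked to keep conversion from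
   unfolding finite supports and quotient representatives. *)

HB.lock Definition free_lift (R : nzRingType) (K : choiceType) (X : lmodType R)
    (f : K -> X) (g : {malg R[K]}) : X := \sum_(x <- msupp g) g@_x *: f x.

Section FreeLift.
Variables (R : nzRingType) (K : choiceType) (X : lmodType R).
Implicit Type f : K -> X.

Lemma free_liftEw f (g : {malg R[K]}) (d : {fset K}) :
  (msupp g `<=` d)%fset -> free_lift f g = \sum_(x <- d) g@_x *: f x.
Proof.
move=> gd; rewrite free_lift.unlock (big_fset_incl _ gd) // => x _.
by rewrite -mcoeff_eq0 => /eqP ->; rewrite scale0r.
Qed.

Lemma free_lift_linear f : linear (free_lift f).
Proof.
move=> a x y.
pose d := (msupp (a *: x + y) `|` (msupp x `|` msupp y))%fset.
rewrite !(@free_liftEw f _ d) ?scaler_sumr -?big_split /=.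
- by apply: eq_bigr => i _; rewrite mcoeffD mcoeffZ scalerDl scalerA.
- by rewrite /d; apply/fsubsetP => z; rewrite !inE => ->; rewrite !orbT.
- by rewrite /d; apply/fsubsetP => z; rewrite !inE => ->; rewrite !orbT.
- by rewrite /d; apply/fsubsetP => z; rewrite !inE => ->.
Qed.

HB.instance Definition _ f :=
  GRing.isLinear.Build R {malg R[K]} X *:%R (free_lift f) (free_lift_linear f).

Lemma free_liftU f x : free_lift f << x >> = f x.
Proof.
rewrite (@free_liftEw f _ [fset x]%fset); last exact: msuppU_le.
by rewrite big_seq_fset1 mcoeffUU scale1r.
Qed.

Lemma malg_basisE (g : {malg R[K]}) : g = \sum_(x <- msupp g) g@_x *: << x >>.
Proof.
rewrite {1}[g]monalgE; apply: eq_bigr => x _; apply/malgP => y.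
by rewrite mcoeffZ !mcoeffU mulr_natr.
Qed.

Lemma malg_ind (P : {malg R[K]} -> Prop) :
  P 0 -> (forall a x g, P g -> P (a *: << x >> + g)) -> forall g, P g.
Proof.
move=> P0 PD g; rewrite [g]malg_basisE.
by elim/big_rec: _ => // x y _; apply: PD.
Qed.

End FreeLift.

Lemma eq_free_lift (R : nzRingType) (K : choiceType) (X : lmodType R)
    (f g : K -> X) x : f =1 g -> free_lift f x = free_lift g x.
Proof. by move=> fg; rewrite free_lift.unlock; apply: eq_bigr => p _; rewrite fg. Qed.

Lemma free_liftP (R : comNzRingType) (K : choiceType) (X : lmodType R)
    (f g : K -> X) a x :
  free_lift (fun p => a *: f p + g p) x = a *: free_lift f x + free_lift g x.
Proof.
rewrite free_lift.unlock scaler_sumr -big_split; apply: eq_bigr => p _ /=.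
by rewrite scalerDr !scalerA mulrC.
Qed.

(** * Tensor products *)

Section Tensor.
Variables (R : comNzRingType) (V W : lmodType R).

Inductive tensor_rel : {malg R[(V * W)%type]} -> Prop :=
| TensorDl v v' w : tensor_rel (<< (v + v', w) >> - (<< (v, w) >> + << (v', w) >>))
| TensorDr v w w' : tensor_rel (<< (v, w + w') >> - (<< (v, w) >> + << (v, w') >>))
| TensorZl a v w : tensor_rel (<< (a *: v, w) >> - a *: << (v, w) >>)
| TensorZr a v w : tensor_rel (<< (v, a *: w) >> - a *: << (v, w) >>).

Definition tensor : Type := mquot (gen_submod tensor_rel).
HB.instance Definition _ := GRing.Lmodule.on tensor.

End Tensor.

HB.lock Definition tpure (R : comNzRingType) (V W : lmodType R) (v : V) (w : W) :
  tensor V W := mpi (gen_submod (@tensor_rel R V W)) << (v, w) >>.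

Section TensorTheory.
Variables (R : comNzRingType) (V W : lmodType R).
Implicit Types (v : V) (w : W).

Lemma tpureDl v v' w : tpure (v + v') w = tpure v w + tpure v' w.
Proof.
rewrite tpure.unlock -[RHS](raddfD (mpi (gen_submod (@tensor_rel R V W)))).
exact/mpi_eqE/mem_gen_submod/TensorDl.
Qed.

Lemma tpureDr v w w' : tpure v (w + w') = tpure v w + tpure v w'.
Proof.
rewrite tpure.unlock -[RHS](raddfD (mpi (gen_submod (@tensor_rel R V W)))).
exact/mpi_eqE/mem_gen_submod/TensorDr.
Qed.

Lemma tpureZl a v w : tpure (a *: v) w = a *: tpure v w.
Proof.
rewrite tpure.unlock -[RHS](linearZ_LR (mpi (gen_submod (@tensor_rel R V W)))).
exact/mpi_eqE/mem_gen_submod/TensorZl.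
Qed.

Lemma tpureZr a v w : tpure v (a *: w) = a *: tpure v w.
Proof.
rewrite tpure.unlock -[RHS](linearZ_LR (mpi (gen_submod (@tensor_rel R V W)))).
exact/mpi_eqE/mem_gen_submod/TensorZr.
Qed.

Lemma tensor_ind (P : tensor V W -> Prop) :
  P 0 -> (forall v w t, P t -> P (tpure v w + t)) -> forall t, P t.
Proof.
move=> P0 PD t; have [g ->] := mpi_surj t.
elim/malg_ind: g => [|a [v w] g Pg]; first by rewrite linear0.
rewrite linearP; have := PD (a *: v) w _ Pg.
by rewrite tpureZl tpure.unlock.
Qed.

End TensorTheory.

(* The linear map induced on the tensor product by a bilinear map [f]; see
   [tensor_lift_linear] and [tensor_liftE]. *)
HB.lock Definition tensor_lift (R : comNzRingType) (V W X : lmodType R)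
    (f : V -> W -> X) (t : tensor V W) : X :=
  free_lift (fun p => f p.1 p.2)
    (repr (t : Quotient.quot (additive_part (gen_submod (@tensor_rel R V W))))).

Section Lift.
Variables (R : comNzRingType) (V W X : lmodType R) (f : V -> W -> X).

Definition bilinear_map : Prop :=
  (forall v, linear (f v)) /\ (forall w, linear (f^~ w)).

Hypothesis f_bilin : bilinear_map.

Let F := free_lift (fun p : V * W => f p.1 p.2).
Let kerF : {pred {malg R[(V * W)%type]}} := fun g => F g == 0.

Let kerF_closed : submod_closed kerF.
Proof.
split; first by rewrite unfold_in /F linear0.
move=> a x y; rewrite !unfold_in => /eqP x0 /eqP y0.
by rewrite [F _]free_lift_linear -!/F x0 y0 scaler0 addr0.
Qed.

HB.instance Definition _ :=
  GRing.isSubmodClosed.Build R {malg R[(V * W)%type]} kerF kerF_closed.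

Let rel_kerF g : g \in gen_submod (@tensor_rel R V W) -> F g = 0.
Proof.
move=> gR; apply/eqP; rewrite -[_ == 0]/(g \in kerF).
have [fr fl] := f_bilin.
apply: (gen_submod_min _ gR) => _ [v v' w|v w w'|a v w|a v w];
  rewrite unfold_in /F linearB ?linearD ?linearZ /= !free_liftU /=
  -?opprD ?scalerN subr_eq0; apply/eqP.
- by have := fl w 1 v v'; rewrite !scale1r.
- by have := fr v 1 w w'; rewrite !scale1r.
- have fl0 : f 0 w = 0.
    by have := fl w (-1) 0 0; rewrite scaler0 addr0 scaleN1r addNr.
  by have := fl w a v 0; rewrite addr0 fl0 addr0.
- have fr0 : f v 0 = 0.
    by have := fr v (-1) 0 0; rewrite scaler0 addr0 scaleN1r addNr.
  by have := fr v a w 0; rewrite addr0 fr0 addr0.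
Qed.

Let tensor_lift_mpi g : tensor_lift f (mpi _ g) = F g.
Proof.
apply/eqP; rewrite -subr_eq0 tensor_lift.unlock -/F -linearB; apply/eqP.
by apply/rel_kerF/mpi_eqE; rewrite /mpi reprK.
Qed.

Lemma tensor_lift_linear : linear (tensor_lift f).
Proof.
move=> a x y; have [x' ->] := mpi_surj x; have [y' ->] := mpi_surj y.
by rewrite -linearP !tensor_lift_mpi /F linearP.
Qed.

Lemma tensor_liftE v w : tensor_lift f (tpure v w) = f v w.
Proof. by rewrite tpure.unlock tensor_lift_mpi /F free_liftU. Qed.

End Lift.

(** * Extension of scalars of a ring along [int -> k] *)

Section IntLinear.
Variables (V : zmodType) (X : lmodType int).

Lemma int_linear (f : zmodule V -> X) : zmod_morphism f -> linear f.
Proof.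
move=> fB n x y.
pose F := HB.pack_for {additive V -> X} (f : V -> X)
  (GRing.isZmodMorphism.Build V X f fB).
have FD u v : f (u + v) = f u + f v := raddfD F u v.
have Fz m u : f (u *~ m) = f u *~ m := raddfMz F m u.
by rewrite FD -[n *: x]/((x : V) *~ n) Fz -scaler_int intz.
Qed.

End IntLinear.

Section BaseChange.
Variables (A : pzRingType) (k : comNzRingType).

(* [zmodule V] is the abelian group [V] regarded as a module over [int]. *)
Definition base_change : Type := tensor (R := int) (zmodule A) (zmodule k).
HB.instance Definition _ := GRing.Zmodule.on base_change.

Definition bpure (a : A) (c : k) : base_change :=
  tpure (a : zmodule A) (c : zmodule k).

Lemma bpureDl a a' c : bpure (a + a') c = bpure a c + bpure a' c.
Proof. exact: tpureDl. Qed.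

Lemma bpureDr a c c' : bpure a (c + c') = bpure a c + bpure a c'.
Proof. exact: tpureDr. Qed.

Lemma base_change_ind (P : base_change -> Prop) :
  P 0 -> (forall a c x, P x -> P (bpure a c + x)) -> forall x, P x.
Proof. exact: (@tensor_ind _ _ _ P). Qed.

Local Notation T := (tensor (R := int) (zmodule A) (zmodule k)).

Section BaseChangeLift.
Variables (X : lmodType int) (f : A -> k -> X).
Hypotheses (fB1 : forall a, zmod_morphism (f a))
           (fB2 : forall c, zmod_morphism (f^~ c)).

Definition base_change_lift (x : base_change) : X :=
  tensor_lift (f : zmodule A -> zmodule k -> X) x.

Let f_bilin : bilinear_map (f : zmodule A -> zmodule k -> X).
Proof. by split=> v; apply: int_linear. Qed.

Lemma base_change_liftE a c : base_change_lift (bpure a c) = f a c.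
Proof. exact: tensor_liftE. Qed.

Lemma base_change_lift_zmod_morphism : zmod_morphism base_change_lift.
Proof.
move=> x y; have L := tensor_lift_linear f_bilin.
have := L (-1) y x; rewrite !scaleN1r ![- _ + _]addrC; exact.
Qed.

End BaseChangeLift.

Definition bmul (x y : base_change) : base_change :=
  base_change_lift (X := T)
    (fun a c => base_change_lift (X := T) (fun b d => bpure (a * b) (c * d)) y) x.

Let inner a c (b : A) (d : k) : T := bpure (a * b) (c * d).

Let bpureBl a a' c : bpure (a - a') c = bpure a c - bpure a' c.
Proof. by apply: (addIr (bpure a' c)); rewrite -bpureDl !subrK. Qed.

Let bpureBr a c c' : bpure a (c - c') = bpure a c - bpure a c'.
Proof. by apply: (addIr (bpure a c')); rewrite -bpureDr !subrK. Qed.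

Let innerB1 a c b : zmod_morphism (inner a c b).
Proof. by move=> d d'; rewrite /inner mulrBr bpureBr. Qed.

Let innerB2 a c d : zmod_morphism ((inner a c)^~ d).
Proof. by move=> b b'; rewrite /inner mulrBr bpureBl. Qed.

Let outer y a c : T := base_change_lift (inner a c) y.

Let outer_pure b d a c : outer (bpure b d) a c = bpure (a * b) (c * d).
Proof. exact: base_change_liftE (innerB1 _ _) (innerB2 _ _) _ _. Qed.

Let outerB y y' a c : outer (y - y') a c = outer y a c - outer y' a c.
Proof. exact: base_change_lift_zmod_morphism (innerB1 _ _) (innerB2 _ _) _ _. Qed.

Let outer0 a c : outer 0 a c = 0.
Proof. by have := outerB 0 0 a c; rewrite !subrr. Qed.

Let outerD y y' a c : outer (y + y') a c = outer y a c + outer y' a c.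
Proof. by rewrite -{1}[y']opprK outerB -[- y']sub0r outerB outer0 sub0r opprK. Qed.

Let outerB1 y a : zmod_morphism (outer y a).
Proof.
move=> c c'; elim/base_change_ind: y => [|b d y IH].
  by rewrite !outer0 subr0.
rewrite !outerD IH !outer_pure mulrBl bpureBr opprD !addrA.
by congr (_ - _); rewrite addrAC.
Qed.

Let outerB2 y c : zmod_morphism ((outer y)^~ c).
Proof.
move=> a a'; elim/base_change_ind: y => [|b d y IH].
  by rewrite !outer0 subr0.
rewrite !outerD IH !outer_pure mulrBl bpureBl opprD !addrA.
by congr (_ - _); rewrite addrAC.
Qed.

Lemma bmul_pure a b c d :
  bmul (bpure a c) (bpure b d) = bpure (a * b) (c * d).
Proof.
rewrite -outer_pure.
exact: base_change_liftE (outerB1 _) (outerB2 _) _ _.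
Qed.

Let bmulBl y : zmod_morphism (bmul^~ y).
Proof. exact: base_change_lift_zmod_morphism (outerB1 y) (outerB2 y). Qed.

Let bmul0l y : bmul 0 y = 0.
Proof. by have := bmulBl y 0 0; rewrite !subrr. Qed.

Lemma bmulDl : left_distributive bmul +%R.
Proof.
move=> x x' y; rewrite -{1}[x']opprK bmulBl.
by rewrite -[- x']sub0r bmulBl bmul0l sub0r opprK.
Qed.

Let bmul_pureE a c y : bmul (bpure a c) y = outer y a c.
Proof. exact: base_change_liftE (outerB1 _) (outerB2 _) _ _. Qed.

Let bmul0r x : bmul x 0 = 0.
Proof.
elim/base_change_ind: x => [|a c x IH]; first exact: bmul0l.
by rewrite bmulDl IH addr0 bmul_pureE outer0.
Qed.

Lemma bmulDr : right_distributive bmul +%R.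
Proof.
move=> x y y'; elim/base_change_ind: x => [|a c x IH].
  by rewrite !bmul0l addr0.
rewrite !bmulDl IH (bmul_pureE a c (y + y')) (bmul_pureE a c y).
rewrite (bmul_pureE a c y') outerD; exact: addrACA.
Qed.

Lemma bmulA : associative bmul.
Proof.
move=> x y z; elim/base_change_ind: x => [|a c x IH]; first by rewrite !bmul0l.
rewrite !bmulDl {}IH; congr (_ + _).
elim/base_change_ind: y => [|a' c' y IH]; first by rewrite bmul0l bmul0r bmul0l.
rewrite !(bmulDl, bmulDr) {}IH; congr (_ + _).
elim/base_change_ind: z => [|a2 c2 z IH]; first by rewrite !bmul0r.
by rewrite !bmulDr {}IH !bmul_pure !mulrA.
Qed.

Lemma bmul1l : left_id (bpure 1 1) bmul.
Proof.
move=> x; elim/base_change_ind: x => [|a c x IH]; first exact: bmul0r.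
by rewrite bmulDr IH bmul_pure !mul1r.
Qed.

Lemma bmul1r : right_id (bpure 1 1) bmul.
Proof.
move=> x; elim/base_change_ind: x => [|a c x IH]; first exact: bmul0l.
by rewrite bmulDl IH bmul_pure !mulr1.
Qed.

HB.instance Definition _ := GRing.Zmodule_isPzRing.Build base_change
  bmulA bmul1l bmul1r bmulDl bmulDr.

Lemma bpureM a b c d : bpure a c * bpure b d = bpure (a * b) (c * d).
Proof. exact: bmul_pure. Qed.

Definition bscale (c : k) (x : base_change) : base_change := bpure 1 c * x.

Lemma bscaleA a b x : bscale a (bscale b x) = bscale (a * b) x.
Proof. by rewrite /bscale mulrA bpureM (mul1r (1 : A)). Qed.

Lemma bscale1 : left_id (1 : k) bscale.
Proof. exact: mul1r. Qed.

Lemma bscaleDr : right_distributive bscale +%R.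
Proof. by move=> c x y; rewrite /bscale mulrDr. Qed.

Lemma bscaleDl x : {morph bscale^~ x : a b / a + b}.
Proof. by move=> a b; rewrite /bscale bpureDr mulrDl. Qed.

HB.instance Definition _ := GRing.Zmodule_isLmodule.Build k base_change
  bscaleA bscale1 bscaleDr bscaleDl.

Lemma bscaleE c a d : c *: bpure a d = bpure a (c * d).
Proof. by rewrite -[LHS]/(bpure 1 c * bpure a d) bpureM (mul1r a). Qed.

Lemma bscaleAl c (x y : base_change) : c *: (x * y) = (c *: x) * y.
Proof. exact: mulrA. Qed.

Lemma bscaleAr c (x y : base_change) : c *: (x * y) = x * (c *: y).
Proof.
rewrite bscaleAl -[c *: x]/(bpure 1 c * x) -[c *: y]/(bpure 1 c * y) mulrA.
congr (_ * y); elim/base_change_ind: x => [|a d x IH]; first by rewrite mulr0 mul0r.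
by rewrite mulrDl mulrDr IH !bpureM (mul1r a) (mulr1 a) [c * d]mulrC.
Qed.

End BaseChange.

(** * Matroids and their flats *)

Record matroid (E : finType) := Matroid {
  mrank :> {set E} -> nat;
  mrank_le_card : forall X, (mrank X <= #|X|)%N;
  mrank_mono : forall X Y : {set E}, X \subset Y -> (mrank X <= mrank Y)%N;
  mrank_submod : forall X Y,
    (mrank (X :|: Y) + mrank (X :&: Y) <= mrank X + mrank Y)%N
}.

Section Flats.
Variables (E : finType) (M : matroid E).

Definition is_flat (F : {set E}) : bool :=
  [forall x, (x \notin F) ==> (M F < M (x |: F))%N].

Record flat := Flat { flat_set :> {set E}; _ : is_flat flat_set }.

HB.instance Definition _ := [isSub for flat_set].
HB.instance Definition _ := [Finite of flat by <:].

(* [covers K L] is [K <. L]. *)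
Definition covers (K L : flat) : bool :=
  (K \proper L) && ~~ [exists X : flat, (K \proper X) && (X \proper L)].

Lemma flatI_proof (K L : flat) : is_flat (K :&: L).
Proof.
have H (F F' : flat) x : x \notin (F : {set E}) ->
    (M (F :&: F') < M (x |: (F :&: F')))%N.
  move=> xF; have /forallP/(_ x)/implyP/(_ xF) := valP F; rewrite /= => ltF.
  have := mrank_submod M (x |: (F :&: F')) F.
  rewrite -setUA (setUidPr (subsetIl F F')).
  have -> : (x |: (F :&: F')) :&: F = F :&: F'.
    apply/setP => y; rewrite !inE; case: eqP => [->|_] /=.
      by rewrite (negPf xF).
    by rewrite andbAC andbb.
  rewrite -(ltn_add2r (M F)) => le; apply: leq_trans le.
  by rewrite addnC ltn_add2r.
apply/forallP => x; apply/implyP; rewrite inE negb_and => /orP[] xN.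
  exact: H.
by rewrite setIC; apply: H.
Qed.

Definition flatI (K L : flat) : flat := Flat (flatI_proof K L).

Lemma is_flat_setT : is_flat setT.
Proof. by apply/forallP => x; rewrite inE. Qed.

Definition flatT : flat := Flat is_flat_setT.

(** * The algebra of flag paths *)

Definition adjacent (K L : flat) : bool := covers K L || covers L K.

(* The nonempty sequence [K_1, ..., K_l] is stored as [(K_1, [:: K_2; ...; K_l])]. *)
Definition is_flag_path (p : flat * seq flat) : bool := path adjacent p.1 p.2.

Record flag_path := FlagPath {
  flag_seq :> flat * seq flat; _ : is_flag_path flag_seq }.

HB.instance Definition _ := [isSub for flag_seq].
HB.instance Definition _ := [Choice of flag_path by <:].

Definition fstart (p : flag_path) : flat := (flag_seq p).1.
Definition fend (p : flag_path) : flat := last (flag_seq p).1 (flag_seq p).2.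

Definition flag_alg : Type := {malg int[flag_path]}.
HB.instance Definition _ := GRing.Lmodule.on flag_alg.

(* The basis element [(K, s_1, ..., s_n)]; by convention 0 when the sequence is
   not a flag path. *)
Definition fpath (K : flat) (s : seq flat) : flag_alg :=
  if insub (K, s) is Some p then << p >> else 0.

Definition fconcat (p q : flag_path) : flag_alg :=
  if fend p == fstart q
  then fpath (fstart p) ((flag_seq p).2 ++ (flag_seq q).2) else 0.

Definition fmul (x y : flag_alg) : flag_alg :=
  free_lift (X := {malg int[flag_path]})
    (fun p => free_lift (X := {malg int[flag_path]}) (fconcat p) y) x.

Definition fone : flag_alg := \sum_(F : flat) fpath F [::].

Lemma fpathE (p : flag_path) : fpath (fstart p) (flag_seq p).2 = << p >>.
Proof. by rewrite /fpath -surjective_pairing valK. Qed.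

Lemma fmul_basis p q : fmul << p >> << q >> = fconcat p q.
Proof. by rewrite /fmul !free_liftU. Qed.

Lemma fmulPl a x y z : fmul (a *: x + y) z = a *: fmul x z + fmul y z.
Proof. by rewrite /fmul linearP. Qed.

Lemma fmulPr a x y z : fmul x (a *: y + z) = a *: fmul x y + fmul x z.
Proof.
rewrite /fmul -free_liftP; apply: eq_free_lift => p; exact: free_lift_linear.
Qed.

Lemma fmul0l x : fmul 0 x = 0.
Proof. by rewrite /fmul linear0. Qed.

Lemma fmul0r x : fmul x 0 = 0.
Proof. by have := fmulPr (-1) x 0 0; rewrite !scaleN1r oppr0 addr0 addNr. Qed.

Lemma fmulDl : left_distributive fmul +%R.
Proof. by move=> x y z; have := fmulPl 1 x y z; rewrite !scale1r. Qed.

Lemma fmulDr : right_distributive fmul +%R.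
Proof. by move=> x y z; have := fmulPr 1 x y z; rewrite !scale1r. Qed.

Lemma fpathM K s L s' : path adjacent K s -> path adjacent L s' ->
  fmul (fpath K s) (fpath L s') =
  if last K s == L then fpath K (s ++ s') else 0.
Proof.
move=> Ks Ls; rewrite {1 2}/fpath.
by rewrite (insubT is_flag_path (x := (K, s)) Ks)
  (insubT is_flag_path (x := (L, s')) Ls) fmul_basis.
Qed.

Lemma fmulA : associative fmul.
Proof.
move=> x y z.
elim/malg_ind: x => [|a p x IH]; first by rewrite !fmul0l.
rewrite !fmulPl {}IH; congr (_ *: _ + _).
elim/malg_ind: y => [|b q y IH]; first by rewrite fmul0l fmul0r fmul0l.
rewrite fmulPl !fmulPr fmulPl {}IH; congr (_ *: _ + _).
elim/malg_ind: z => [|c r z IH]; first by rewrite !fmul0r.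
rewrite !fmulPr {}IH; congr (_ *: _ + _).
rewrite -!fpathE; case: p q r => [[K s] Ks] [[L t] Lt] [[N u] Nu] /=.
rewrite /fstart /is_flag_path /= in Ks Lt Nu *.
rewrite !fpathM //; have [KL|KL] := eqVneq (last K s) L;
  have [LN|LN] := eqVneq (last L t) N; rewrite ?fmul0l ?fmul0r //.
- by rewrite !fpathM ?cat_path ?Ks ?Lt ?KL ?LN //= last_cat KL LN !eqxx catA.
- by rewrite fpathM ?cat_path ?Ks ?KL //= last_cat KL (negPf LN).
- by rewrite fpathM ?cat_path ?Lt ?LN //= (negPf KL).
Qed.

Lemma fmul1l : left_id fone fmul.
Proof.
move=> x; elim/malg_ind: x => [|a p x IH]; first exact: fmul0r.
rewrite fmulPr IH; congr (_ *: _ + _).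
rewrite -fpathE; case: p => [[K s] Ks]; rewrite /fstart /is_flag_path /= in Ks *.
rewrite /fone (big_morph (fmul^~ (fpath K s)) (fun x y => fmulDl x y _) (fmul0l _)).
rewrite (bigD1 K) //= fpathM //= eqxx big1 ?addr0 // => F /negPf FK.
by rewrite fpathM //= FK.
Qed.

Lemma fmul1r : right_id fone fmul.
Proof.
move=> x; elim/malg_ind: x => [|a p x IH]; first exact: fmul0l.
rewrite fmulPl IH; congr (_ *: _ + _).
rewrite -fpathE; case: p => [[K s] Ks]; rewrite /fstart /is_flag_path /= in Ks *.
rewrite /fone (big_morph (fmul (fpath K s)) (fmulDr _) (fmul0r _)).
rewrite (bigD1 (last K s)) //= fpathM //= eqxx cats0 big1 ?addr0 // => F.
by rewrite eq_sym => /negPf FK; rewrite fpathM //= FK.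
Qed.

HB.instance Definition _ := GRing.Zmodule_isPzRing.Build flag_alg
  fmulA fmul1l fmul1r fmulDl fmulDr.

(* In [MeetNeq] the sequence [K, K :&: K', K'] is a flag path: [K] and [K'] have
   the same rank, so [K :&: K'] is covered by [K'] as soon as it is by [K]. *)
Inductive flag_relation : flag_alg -> Prop :=
| FSup (L K : flat) : L \proper K -> M K = (M L + 2)%N ->
    flag_relation (\sum_(X : flat | covers L X && covers X K) fpath L [:: X; K])
| FSdown (L K : flat) : L \proper K -> M K = (M L + 2)%N ->
    flag_relation (\sum_(X : flat | covers L X && covers X K) fpath K [:: X; L])
| MeetEq (K L : flat) : covers K L ->
    flag_relation (fpath K [:: L; K] - fpath K [::] *+ #|L :\: K|)
| MeetNeq (K K' L : flat) : covers K L -> covers K' L -> K != K' ->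
    covers (flatI K K') K ->
    flag_relation (fpath K [:: L; K'] - (- fpath K [:: flatI K K'; K']))
| MeetZero (K K' L : flat) : covers K L -> covers K' L -> K != K' ->
    ~~ covers (flatI K K') K ->
    flag_relation (fpath K [:: L; K']).

Definition flag_ideal : {pred flag_alg} := gen_ideal flag_relation.
HB.instance Definition _ := TIdeal.on flag_ideal.

(* [S(M)] *)
Definition schur : Type := rquot flag_ideal.
HB.instance Definition _ := GRing.PzRing.on schur.

(* Evaluation at the path [(E)] descends to [S(M)]; this shows that [S(M)] and
   its base changes are nonzero. *)

Let top : flag_path := @FlagPath (flatT, [::]) isT.

Let coefU (p q : flag_path) : << p >>@_q = (p == q)%:R :> int.
Proof. exact: mcoeffU. Qed.

Let fpath_top K s : (fpath K s)@_top = ((K, s) == (flatT, [::]))%:R :> int.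
Proof.
rewrite /fpath; case: insubP => [u _ uE|nKs].
  by rewrite coefU -val_eqE uE.
by rewrite mcoeff0; case: eqP nKs => // ->.
Qed.

Let concat_top p q : (fconcat p q)@_top = << p >>@_top * << q >>@_top :> int.
Proof.
rewrite !coefU -!val_eqE /fconcat /fend /fstart /=.
case: p q => [[K s] Ks] [[L t] Lt] /=.
case: ifP => [/eqP<-|nKL]; rewrite ?fpath_top ?mcoeff0 -natrM mulnb !xpair_eqE /=.
  case: s {Ks} => [|? ?] /=; rewrite ?andbF //.
  by case: (K == flatT).
case: s {Ks} nKL => [|? ?] /=; rewrite ?andbF //.
by case: (eqVneq K flatT) => //= ->; rewrite eq_sym => ->; rewrite andFb.
Qed.

Let mul_top x y : (fmul x y)@_top = x@_top * y@_top :> int.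
Proof.
elim/malg_ind: x => [|a p x IH]; first by rewrite fmul0l mcoeff0 mul0r.
rewrite fmulPl !mcoeffD IH !mcoeffZ mulrDl -mulrA; congr (_ * _ + _).
elim/malg_ind: y {IH} => [|b q y IH]; first by rewrite fmul0r mcoeff0 mulr0.
by rewrite fmulPr !mcoeffD IH !mcoeffZ mulrDr fmul_basis concat_top mulrCA.
Qed.

Let ker_top : {pred flag_alg} := fun x => x@_top == 0 :> int.

Let ker_top_zmod : zmod_closed ker_top.
Proof.
split; first by rewrite unfold_in mcoeff0.
by move=> x y; rewrite !unfold_in mcoeffB => /eqP-> /eqP->; rewrite subr0.
Qed.

Let ker_top_two_sided : two_sided ker_top.
Proof.
move=> a x; rewrite !unfold_in => /eqP x0.
by rewrite -[a * x]/(fmul a x) -[x * a]/(fmul x a) !mul_top x0 mulr0 mul0r.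
Qed.

HB.instance Definition _ := GRing.isZmodClosed.Build flag_alg ker_top ker_top_zmod.
HB.instance Definition _ := isTwoSided.Build flag_alg ker_top ker_top_two_sided.

Let relation_top x : x \in flag_ideal -> x@_top = 0 :> int.
Proof.
move=> xI; apply/eqP; rewrite -[_ == 0]/(x \in ker_top).
apply: (gen_ideal_min _ xI) => _ [L K _ _|L K _ _|K L KL|K K' L _ _ _ _|K K' L _ _ _ _];
  rewrite unfold_in.
- by rewrite raddf_sum big1 // => X _; rewrite /= fpath_top xpair_eqE andbF.
- by rewrite raddf_sum big1 // => X _; rewrite /= fpath_top xpair_eqE andbF.
- rewrite mcoeffB mcoeffMn !fpath_top !xpair_eqE andbF eqxx andbT sub0r oppr_eq0.
  have [KT|_] := eqVneq K flatT; last by rewrite mul0rn.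
  by case/andP: KL; rewrite KT /= properE subsetT andbF.
- by rewrite mcoeffB mcoeffN !fpath_top !xpair_eqE !andbF oppr0 subr0.
- by rewrite fpath_top xpair_eqE andbF.
Qed.

Lemma schur_base_change_neq0 (k : comNzRingType) :
  (1 : base_change schur k) != 0.
Proof.
pose ev (a : schur) : int := (repr (a : Quotient.quot flag_ideal))@_top.
have evE x : ev (rpi flag_ideal x) = x@_top.
  apply/eqP; rewrite -subr_eq0 -mcoeffB; apply/eqP/relation_top/rpi_eqE.
  by rewrite /rpi reprK.
have evB : zmod_morphism ev.
  move=> a b; have [x ->] := rpi_surj a; have [y ->] := rpi_surj b.
  by rewrite -raddfB !evE mcoeffB.
pose f (a : schur) (c : k) : zmodule k := c *~ ev a.
have fB1 a : zmod_morphism (f a) by move=> c d; rewrite /f mulrzBl.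
have fB2 c : zmod_morphism (f^~ c) by move=> a b; rewrite /f evB mulrzBr.
have F1 := base_change_liftE fB1 fB2 1 1.
have FB := base_change_lift_zmod_morphism fB1 fB2.
have F0 : base_change_lift f 0 = 0 by have := FB 0 0; rewrite !subrr.
apply/eqP => e; move: F1; rewrite -[bpure 1 1]/(1 : base_change _ _) e F0 /f.
rewrite -[X in ev X]/(rpi flag_ideal 1) evE -[1 : flag_alg]/fone.
rewrite /fone raddf_sum (bigD1 flatT) //= fpath_top eqxx big1 => [|F /negPf FT].
  by rewrite addr0 mulr1z => /eqP; rewrite eq_sym oner_eq0.
by rewrite fpath_top xpair_eqE FT.
Qed.

End Flats.

(* [S_k(M)] *)
Definition schur_over (k : comNzRingType) (E : finType) (M : matroid E) : Type :=
  base_change (schur M) k.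

Section SchurOver.
Variables (k : comNzRingType) (E : finType) (M : matroid E).

HB.instance Definition _ := GRing.PzRing.on (schur_over k M).
HB.instance Definition _ := GRing.Lmodule.on (schur_over k M).
HB.instance Definition _ := GRing.PzSemiRing_isNonZero.Build (schur_over k M)
  (schur_base_change_neq0 M k).
HB.instance Definition _ := GRing.LSemiModule_isLSemiAlgebra.Build k
  (schur_over k M) (@bscaleAl (schur M) k).
HB.instance Definition _ := GRing.LSemiAlgebra_isSemiAlgebra.Build k
  (schur_over k M) (@bscaleAr (schur M) k).

(* The idempotent [(F)]. *)
Definition flat_idem (F : flat M) : schur_over k M :=
  bpure (rpi (@flag_ideal E M) (fpath F [::])) 1.

End SchurOver.

Arguments flat_idem k {E} M F.

(** * Reedy algebras *)

Definition finite_dimensional (k : fieldType) (V : lmodType k) : Prop :=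
  exists (n : nat) (b : 'I_n -> V),
    forall x, exists c : 'I_n -> k, x = \sum_i c i *: b i.

Definition complete_orthogonal_idempotents
    (A : pzRingType) (I : finType) (e : I -> A) : Prop :=
  (forall i j, e i * e j = if i == j then e i else 0) /\ \sum_i e i = 1.

Section Corner.
Variables (k : fieldType) (A : algType k).

(* [e U f] *)
Definition corner (e : A) (U : {pred A}) (f : A) : {pred A} :=
  [pred x | `[< exists2 a, a \in U & x = e * a * f >]].

Lemma corner_closed e (U : submodClosed A) f : submod_closed (corner e U f).
Proof.
split; first by apply/asboolP; exists 0; rewrite ?rpred0 // mulr0 mul0r.
move=> c _ _ /asboolP[a aU ->] /asboolP[b bU ->]; apply/asboolP.
exists (c *: a + b); first by rewrite rpredD ?rpredZ.
by rewrite mulrDr mulrDl -scalerAr -scalerAl.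
Qed.

HB.instance Definition _ e (U : submodClosed A) f :=
  GRing.isSubmodClosed.Build k A (corner e U f) (corner_closed e U f).

Definition one_dimensional (U : submodClosed A) : Prop :=
  exists f : {linear k^o -> subspace U}, bijective f.

Definition mult_map (U W : submodClosed A) :
    tensor (subspace U) (subspace W) -> A :=
  tensor_lift (fun (u : subspace U) (w : subspace W) => val u * val w).

Lemma mult_map_linear U W : linear (@mult_map U W).
Proof.
apply: tensor_lift_linear; split=> u c v w /=.
  by rewrite mulrDr scalerAr.
by rewrite mulrDl scalerAl.
Qed.

Lemma mult_mapE (U W : submodClosed A) (u : subspace U) (w : subspace W) :
  mult_map (tpure u w) = val u * val w.
Proof.
apply: tensor_liftE; split=> {u w} u c v w /=.
  by rewrite mulrDr scalerAr.
by rewrite mulrDl scalerAl.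
Qed.

Section Reedy.
Variables (I : finType) (e : I -> A).

(* The map [(+)_l e_j A^+ e_l (x) e_l A^- e_i -> A] induced by multiplication;
   an element of the direct sum is the family of its components. *)
Definition triangular_map (Ap Am : subalgClosed A) (j i : I)
    (t : forall l, tensor (subspace (corner (e j) Ap (e l)))
                          (subspace (corner (e l) Am (e i)))) : A :=
  \sum_l mult_map (t l).

Definition triangular_decomposition (Ap Am : subalgClosed A) : Prop :=
  forall j i,
    (forall t t' : forall l, tensor (subspace (corner (e j) Ap (e l)))
                                    (subspace (corner (e l) Am (e i))),
       triangular_map t = triangular_map t' -> forall l, t l = t' l) /\
    (forall x, x \in corner (e j) predT (e i) <->
       exists t : forall l, tensor (subspace (corner (e j) Ap (e l)))
                                   (subspace (corner (e l) Am (e i))),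
         x = triangular_map t).

Definition nonzero (U : {pred A}) : Prop := exists2 x, x \in U & x != 0.

(* [subalgClosed] predicates contain the unit of [A].  The idempotents [e i] are
   nonzero by the one-dimensionality conditions, hence pairwise distinct, so
   [i != j] means [e i != e j]. *)
Definition reedy_algebra : Prop :=
  [/\ finite_dimensional A, complete_orthogonal_idempotents e &
   exists (deg : I -> nat) (Ap Am : subalgClosed A),
   [/\ (forall i, one_dimensional (corner (e i) Ap (e i))) /\
       (forall i j, i != j -> nonzero (corner (e j) Ap (e i)) ->
          (deg i < deg j)%N),
       (forall i, one_dimensional (corner (e i) Am (e i))) /\
       (forall i j, i != j -> nonzero (corner (e j) Am (e i)) ->
          (deg j < deg i)%N)
     & triangular_decomposition Ap Am]].

End Reedy.
End Corner.

(** * Quasi-hereditary algebras *)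

Definition projective (R : pzRingType) (P : lmodType R) : Prop :=
  forall (M N : lmodType R) (g : {linear M -> N}) (h : {linear P -> N}),
    (forall y, exists x, g x = y) ->
    exists f : {linear P -> M}, forall x, g (f x) = h x.

Definition maximal_left_ideal (R : pzRingType) (I : submodClosed R^o) : Prop :=
  (1 : R^o) \notin I /\
  forall J : submodClosed R^o, {subset I <= J} -> (1 : R^o) \notin J ->
    {subset J <= I}.

Definition jacobson_radical (R : pzRingType) (x : R) : Prop :=
  forall I : submodClosed R^o, maximal_left_ideal I -> (x : R^o) \in I.

(* [J J = J], [J rad(R) J = 0] and [J] is projective as a left module.  Under the
   first two conditions projectivity as a left and as a right module are
   equivalent when [R] is a finite-dimensional algebra. *)
Definition heredity_ideal (R : pzRingType) (J : tideal R) : Prop :=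
  [/\ forall x, x \in J -> exists (n : nat) (y z : 'I_n -> R),
        (forall i, y i \in J /\ z i \in J) /\ x = \sum_i y i * z i,
      forall x r y, x \in J -> jacobson_radical r -> y \in J -> x * r * y = 0
    & projective (subspace (left_regular J))].

(* There is a chain [0 = J 0 <= J 1 <= ... <= J n = A] of ideals with each
   [J i.+1 / J i] a heredity ideal of [A / J i].  The inclusions need not be
   strict: the zero ideal is a heredity ideal, so repetitions are harmless. *)
Definition quasi_hereditary (k : fieldType) (A : algType k) : Prop :=
  finite_dimensional A /\
  exists (n : nat) (J : nat -> tideal A),
    [/\ J 0 =i pred1 0, J n =i predT &
     forall i, (i < n)%N ->
       {subset J i <= J i.+1} /\ heredity_ideal (ideal_image (J := J i) (J i.+1))].

(* Main.v *)
From HB Require Import structures.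
From mathcomp Require Import all_boot all_algebra.
From mathcomp Require Import boolp monalg.
Require Import Defs.

(* By the meet relation an up step followed by a down step is rewritten into a
   down step followed by an up step, so every flag path reduces to a multiple of
   a "valley": a descending path followed by an ascending one.  This reduction is
   compatible with (FS) (the ambiguities sum_X (L <. X <. K >. K') and
   (K <. P >. X >. Q) resolve by submodularity of the rank and by counting P \ Q
   along the flats X between Q and P), hence S_k(M) is spanned by valleys with
   only the (FS) relations between them.  Taking for A^+ the span of the
   descending paths, for A^- the span of the ascending ones and for the degree
   the rank, this is the triangular decomposition.  The ideals J_n generated by
   the idempotents of the flats of rank < n form a heredity chain: modulo J_n the
   corners between flats of rank n are k or 0, which handles the radical, and
   J_(n+1) / J_n is the sum over the flats l of rank n of (A / J_n) e_l (x) e_l A^-,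
   which is projective. *)

(** The difficulty is to show that valleys satisfy no relation besides (FS). This is done dually:
    every function on valleys that vanishes on the (FS) sums extends to a linear map on $S_k(M)$.
    The defining ideal is compared with the set of all x such that every compatible function kills
    the reduction of x y for all y. Multiplication on the left by a path turns compatible functions
    into compatible ones, which is the ambiguity K <. P >. X >. Q; the ambiguity L <. X <. K >. K'
    puts the ascending (FS) relations into that set. Later maps arise by choosing a target: the
    tensor product itself gives injectivity in the triangular decomposition, the field shows that
    the idempotents are nonzero, and the algebra gives the coordinates behind projectivity. Paths
    multiply from left to right, so $e_j A e_i$ is spanned by paths from j to i; this is why the
    descending paths form $A^+$. Reduction never raises the bottom of a valley, so the valleys with
    bottom of rank < n span an ideal, and this describes $J_n$ explicitly. *)

Set Implicit Arguments.
Unset Strict Implicit.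
Unset Printing Implicit Defensive.

Import GRing.Theory.
Local Open Scope ring_scope.

(** * Flats of a matroid *)

Section Lattice.
Variables (E : finType) (M : matroid E).
Implicit Types (F G K L P Q X Y : flat M) (S T : {set E}).

Lemma flat_rank_lt F G : F \proper G -> (M F < M G)%N.
Proof.
case/properP=> FG [x xG xF].
have /forallP/(_ x)/implyP/(_ xF) ltF := valP F; apply: leq_trans ltF _.
by apply: mrank_mono; rewrite subUset sub1set xG.
Qed.

Lemma flat_sub_eq F G : F \subset G -> (M G <= M F)%N -> F = G.
Proof.
move=> FG GF; apply: val_inj; apply/eqP; rewrite eqEproper FG /=.
by apply: contraL GF => /flat_rank_lt; rewrite -ltnNge.
Qed.

Lemma mem_flat_sub F S : (S \subset F) = (M (S :|: F) <= M F)%N.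
Proof.
apply/idP/idP => [/setUidPr -> //|le]; apply/subsetP => x xS.
apply/negPn/negP => xF; have /forallP/(_ x)/implyP/(_ xF) := valP F.
rewrite ltnNge => /negP; apply; apply: leq_trans le.
by apply: mrank_mono; rewrite setSU // sub1set.
Qed.

(** A largest set of the same rank containing [S] is a flat. Submodularity against a flat [G]
    containing [S] shows that adjoining it to [G] does not raise the rank, so it lies in [G]. *)
Lemma closure_exists S : exists F : flat M,
  [/\ S \subset F, M F = M S & forall G, S \subset G -> F \subset G].
Proof.
pose p T := (S \subset T) && (M T == M S).
have pS : p S by rewrite /p subxx eqxx.
case: (arg_maxnP (fun T : {set E} => #|T|) pS) => C /andP[SC /eqP rC] maxC.
have flatC : is_flat M C.
  apply/forallP => x; apply/implyP => xC; rewrite ltn_neqAle andbC.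
  rewrite mrank_mono ?subsetUr //=; apply: contraL (xC) => /eqP eC.
  have /maxC : p (x |: C).
    by rewrite /p -eC rC eqxx andbT (subset_trans SC) ?subsetUr.
  by rewrite cardsU1 xC /= add1n /= ltnn.
exists (Flat flatC); split=> // G SG; rewrite mem_flat_sub /= -(leq_add2r (M C)).
rewrite [leqRHS]addnC; apply: leq_trans (mrank_submod M C G).
by rewrite leq_add2l rC mrank_mono // subsetI SC.
Qed.

Definition closure S : flat M := sval (cid (closure_exists S)).

Lemma sub_closure S : S \subset closure S.
Proof. by rewrite /closure; case: cid => F []. Qed.

Lemma rank_closure S : M (closure S) = M S.
Proof. by rewrite /closure; case: cid => F []. Qed.

Lemma closure_min S G : S \subset G -> closure S \subset G.
Proof. by rewrite /closure; case: cid => F [_ _ +] /= => /(_ G). Qed.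

Lemma rank_setU1 x S : (M (x |: S) <= (M S).+1)%N.
Proof.
apply: leq_trans (leq_trans (leq_addr _ _) (mrank_submod M [set x] S)) _.
by rewrite -add1n leq_add2r (leq_trans (mrank_le_card _ _)) ?cards1.
Qed.

Lemma rank_closure_setU1 x F : x \notin (F : {set E}) ->
  M (closure (x |: F)) = (M F).+1.
Proof.
move=> xF; rewrite rank_closure; apply/eqP; rewrite eqn_leq rank_setU1 /=.
by have /forallP/(_ x)/implyP/(_ xF) := valP F.
Qed.

(** For x in [L] outside [K], the closure of [x |: K] has rank one more than [K] and lies in [L], so
    nothing strictly between forces [L] to have that rank. Covering thus becomes rank arithmetic. *)
Lemma coversE K L : covers K L = (K \subset L) && (M L == (M K).+1).
Proof.
apply/andP/andP => [[KL nKL]|[KL /eqP rL]].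
  split; first exact: proper_sub.
  have [sKL [x xL xK]] := properP KL.
  set C := closure (x |: K); have rC : M C = _ := rank_closure_setU1 xK.
  have KC : K \subset C by rewrite (subset_trans _ (sub_closure _)) ?subsetUr.
  have CL : C \subset L by apply: closure_min; rewrite subUset sub1set xL.
  rewrite eqn_leq -{2}rC mrank_mono // andbT -rC leqNgt.
  apply: contra nKL => ltCL; apply/existsP; exists C; rewrite !properE KC CL /=.
  apply/andP; split; apply/negP => /(mrank_mono M); first by rewrite rC ltnn.
  by rewrite leqNgt => /negP.
split; first by rewrite properE KL; apply/negP => /(mrank_mono M); rewrite rL ltnn.
apply/existsP => -[X /andP[/flat_rank_lt KX /flat_rank_lt]].
by rewrite rL ltnS leqNgt KX.
Qed.

Lemma covers_sub K L : covers K L -> K \subset L.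
Proof. by rewrite coversE => /andP[]. Qed.

Lemma covers_rank K L : covers K L -> M L = (M K).+1.
Proof. by rewrite coversE => /andP[_ /eqP]. Qed.

Lemma covers_asym K L : covers K L -> covers L K = false.
Proof.
move=> /covers_rank e; apply/negP => /covers_rank; rewrite e => /eqP.
by rewrite -[X in X == _]addn0 -addn2 eqn_add2l.
Qed.

Lemma rank_flatI_lt K K' : K != K' -> M K = M K' -> (M (flatI K K') < M K)%N.
Proof.
move=> neq r; rewrite flat_rank_lt // properE subsetIl subsetI subxx /=.
by apply: contra neq => /flat_sub_eq ->; rewrite ?r.
Qed.

Lemma flatIC K K' : flatI K K' = flatI K' K.
Proof. by apply: val_inj; rewrite /= setIC. Qed.

Lemma covers_flatIE K K' : covers (flatI K K') K = (M K == (M (flatI K K')).+1).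
Proof. by rewrite coversE /= subsetIl. Qed.

Definition between Q P X := covers Q X && covers X P.

Lemma between_rank Q P X : between Q P X -> M X = (M Q).+1 /\ M P = (M Q).+2.
Proof. by move=> /andP[/covers_rank eX /covers_rank eP]; rewrite eP eX. Qed.

(** The sets [X :\: Q] partition [P :\: Q]: the only X containing a given point x is the closure of
    [x |: Q]. *)
Lemma sum_between Q P : Q \subset P -> M P = (M Q).+2 ->
  (\sum_(X | between Q P X) #|X :\: Q| = #|P :\: Q|)%N.
Proof.
move=> QP rP.
under eq_bigr do rewrite -sum1_card big_mkcond /=.
rewrite exchange_big -sum1_card [RHS]big_mkcond /=.
apply: eq_bigr => x _; rewrite inE; case: ifPn => [/andP[xQ xP]|xPQ]; last first.
  apply: big1 => X /andP[_ /covers_sub/subsetP XP]; rewrite inE.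
  by case: ifP => // /andP[xQ /XP xP]; rewrite xQ xP in xPQ.
have sC : x |: Q \subset P by rewrite subUset sub1set xP.
have := sub_closure (x |: Q); rewrite subUset sub1set => /andP[xC QC].
have bC : between Q P (closure (x |: Q)).
  rewrite /between !coversE QC closure_min //= rank_closure_setU1 //.
  by rewrite rP !eqxx.
rewrite (bigD1 _ bC) /= inE xQ xC big1 // => X /andP[bX neX].
rewrite inE xQ /=; case: ifP => // xX; case/eqP: neX; apply/esym/flat_sub_eq.
  apply: closure_min; rewrite subUset sub1set xX.
  by case/andP: bX => /covers_sub.
by rewrite rank_closure_setU1 //; have [-> _] := between_rank bX.
Qed.

Lemma flatI_below Q P X K : between Q P X -> covers K P -> Q \subset K ->
  X != K -> flatI K X = Q.
Proof.
move=> bX KP QK XK; apply/esym/flat_sub_eq.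
  by rewrite subsetI QK; case/andP: bX => /covers_sub.
have [rX rP] := between_rank bX.
have rK : M K = M X by apply/eqP; rewrite rX -eqSS -(covers_rank KP) rP.
by rewrite -ltnS -rX -rK; apply: rank_flatI_lt => //; rewrite eq_sym.
Qed.

(** Dropping the block of [K] from the partition of [sum_between] leaves [P :\: K]. This identity
    makes the coefficients of the meet relation cancel in both ambiguities. *)
Lemma card_setD_covers Q P K : between Q P K ->
  #|P :\: K| = (\sum_(X | between Q P X && (X != K)) #|X :\: Q|)%N.
Proof.
move=> bK; have /andP[/covers_sub QK /covers_sub KP] := bK.
have := sum_between (subset_trans QK KP); have [_ rP] := between_rank bK.
move/(_ rP); rewrite (bigD1 _ bK) /= => eD.
apply: (@addnI #|K :\: Q|); rewrite {}eD -[RHS](cardsID K).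
congr (_ + _)%N; apply: eq_card => x; rewrite !inE.
  by case: (boolP (x \in (K : {set E}))) => [/(subsetP KP) ->|]; rewrite ?andbF ?andbT.
by case: (boolP (x \in (Q : {set E}))) => [/(subsetP QK) ->|].
Qed.

(* The inverse of [X |-> K :&: X] is [Y |-> closure (Y :|: Q)], whose rank is
   controlled by submodularity. *)
Lemma sum_flatI (V : nmodType) (f : flat M -> V) Q P K :
    covers K P -> Q \subset P -> M P = (M Q).+2 -> ~~ (Q \subset K) ->
    M Q = (M (flatI K Q)).+1 ->
  \sum_(X | between Q P X && covers (flatI K X) K) f (flatI K X) =
  \sum_(Y | between (flatI K Q) K Y) f Y.
Proof.
move=> KP QP rP QK rQ; have rK : M K = (M Q).+1.
  by apply/eqP; rewrite -eqSS -(covers_rank KP) rP.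
pose h Y := closure (Y :|: Q).
have hP Y : between (flatI K Q) K Y ->
  [/\ between Q P (h Y), flatI K (h Y) = Y & covers (flatI K (h Y)) K].
  move=> bY; have [rY _] := between_rank bY; have /andP[ZY YK] := bY.
  have := sub_closure (Y :|: Q); rewrite subUset -/(h Y) => /andP[sY sQ].
  have hYP : h Y \subset P.
    by apply: closure_min; rewrite subUset QP (subset_trans (covers_sub YK)) ?covers_sub.
  have le : (M (h Y) <= (M Q).+1)%N.
    rewrite rank_closure -(leq_add2r (M (Y :&: Q))).
    apply: leq_trans (mrank_submod M Y Q) _.
    have : (M (flatI K Q) <= M (Y :&: Q))%N.
      by rewrite mrank_mono //= subsetI subsetIr (covers_sub ZY).
    by rewrite rY rQ !addSn addnS !ltnS addnC leq_add2r.
  have ge : (M Q < M (h Y))%N.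
    rewrite flat_rank_lt // properE sQ; apply: contraL ZY => hQ.
    rewrite coversE; apply/negP => /andP[_]; rewrite -rQ => /eqP e.
    have /(mrank_mono M) : Y \subset flatI K Q.
      by rewrite subsetI covers_sub //= (subset_trans sY).
    by rewrite e rQ ltnn.
  have rh : M (h Y) = (M Q).+1 by apply/eqP; rewrite eqn_leq le ge.
  have eY : flatI K (h Y) = Y.
    apply/esym/flat_sub_eq; first by rewrite subsetI covers_sub.
    rewrite rY -rQ -ltnS -rK; apply: rank_flatI_lt; last by rewrite rh rK.
    by apply: contra QK => /eqP ->.
  by rewrite /between eY; split=> //; rewrite !coversE sQ hYP rh rP !eqxx.
rewrite (reindex_onto h (flatI K)) /=.
  apply: eq_big => [Y|Y /andP[_ /eqP ->]] //.
  apply/idP/idP => [/andP[/andP[bX cI] /eqP eY]|/hP[-> -> ->]]; last by rewrite eqxx.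
  have : flatI K Q \subset flatI K (h Y).
    by rewrite setIS //; case/andP: bX => /covers_sub.
  move: cI; rewrite eY /between => cI ZY; rewrite cI andbT coversE ZY /=.
  by rewrite -rQ -eqSS -rK (covers_rank cI).
move=> X /andP[bX cI]; have /andP[/covers_sub QX _] := bX.
have [rX _] := between_rank bX.
apply: flat_sub_eq; first by apply: closure_min; rewrite subUset subsetIr.
rewrite rX flat_rank_lt // properE; have := sub_closure (flatI K X :|: Q).
rewrite subUset => /andP[sI ->] /=; apply: contraL cI => hQ.
have /(mrank_mono M) le : flatI K X \subset flatI K Q.
  by rewrite subsetI subsetIl (subset_trans sI).
by rewrite covers_flatIE rK rQ eqSS neq_ltn [X in _ || X]ltnS le orbT.
Qed.
End Lattice.

(** * Reduction to valleys *)

Section NormalForm.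
Variables (E : finType) (M : matroid E).
Implicit Types (F G K L P Q X Y : flat M) (d u s : seq (flat M)).

Definition down : rel (flat M) := fun K L => covers L K.
Definition up : rel (flat M) := @covers E M.

(* A valley [K > ... > l < ... < G] is stored as [K], the tail [d] of its
   descending part and the tail [u] of its ascending part.  [ev] is a map on the
   valleys starting at [K], extended by linearity; [push K L d u ev] is its value
   on the reduction of [(K <. L) * (L :: d ++ u)] and [nf K s ev] its value on the
   reduction of the flag path [(K, s)].  Passing [ev] as a continuation avoids
   formal combinations of valleys. *)
Fixpoint push (T : zmodType) K L d u (ev : seq (flat M) -> seq (flat M) -> T) : T :=
  if d is L' :: d' then
    if L' == K then ev d' u *+ #|L :\: K|
    else if covers (flatI K L') K then
      - push (flatI K L') L' d' u (fun d u => ev (flatI K L' :: d) u)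
    else 0
  else ev [::] (L :: u).

Fixpoint nf (T : zmodType) K s (ev : seq (flat M) -> seq (flat M) -> T) : T :=
  if s is L :: s' then
    nf L s' (fun d u => if covers L K then ev (L :: d) u else push K L d u ev)
  else ev [::] [::].

Section Fixed.
Variable T : zmodType.
Implicit Types ev : seq (flat M) -> seq (flat M) -> T.

Lemma eq_push K L d u ev ev' : ev =2 ev' -> push K L d u ev = push K L d u ev'.
Proof.
elim: d K L ev ev' => [|L' d IH] K L ev ev' e /=; first exact: e.
by rewrite e; case: ifP => // _; case: ifP => // _; congr (- _); apply: IH.
Qed.

Lemma sum_push (I : Type) (r : seq I) (C : pred I) K L d u
    (ev : I -> seq (flat M) -> seq (flat M) -> T) :
  \sum_(i <- r | C i) push K L d u (ev i) =
  push K L d u (fun d u => \sum_(i <- r | C i) ev i d u).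
Proof.
elim: d K L ev => [|L' d IH] K L ev //=; case: ifP => _; first by rewrite sumrMnl.
by case: ifP => _; [rewrite sumrN IH | rewrite big1].
Qed.

Lemma push_mulrn K L d u ev n :
  push K L d u (fun d u => ev d u *+ n) = push K L d u ev *+ n.
Proof.
elim: d K L ev => [|L' d IH] K L ev //=; case: ifP => _; first by rewrite mulrnAC.
by case: ifP => _; [rewrite IH mulNrn | rewrite mul0rn].
Qed.

Lemma pushN K L d u ev : push K L d u (fun d u => - ev d u) = - push K L d u ev.
Proof.
elim: d K L ev => [|L' d IH] K L ev //=; case: ifP => _; first by rewrite mulNrn.
by case: ifP => _; [rewrite IH | rewrite oppr0].
Qed.

Lemma push0 K L d u : push K L d u (fun _ _ => 0 : T) = 0.
Proof.
elim: d K L => [|L' d IH] K L //=; case: ifP => _; first by rewrite mul0rn.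
by case: ifP => _ //; rewrite IH oppr0.
Qed.

Lemma eq_nf K s ev ev' : ev =2 ev' -> nf K s ev = nf K s ev'.
Proof.
elim: s K ev ev' => [|L s IH] K ev ev' e /=; first exact: e.
by apply: IH => d u; rewrite e (eq_push _ _ _ _ e).
Qed.

Lemma sum_nf (I : Type) (r : seq I) (C : pred I) K s
    (ev : I -> seq (flat M) -> seq (flat M) -> T) :
  \sum_(i <- r | C i) nf K s (ev i) =
  nf K s (fun d u => \sum_(i <- r | C i) ev i d u).
Proof.
elim: s K ev => [|L s IH] K ev //=; rewrite IH; apply: eq_nf => d u.
by case: ifP => _ //; rewrite sum_push.
Qed.

(** Reduction preserves both end points and never raises the bottom; the rank bound later controls
    the ideals [low_ideal]. *)
Lemma push_ind (C : T -> Prop) K L d u ev :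
    C 0 -> (forall x, C x -> C (- x)) -> (forall x n, C x -> C (x *+ n)) ->
    covers K L -> path down L d -> path up (last L d) u ->
    (forall d' u', path down K d' -> path up (last K d') u' ->
       last (last K d') u' = last (last L d) u ->
       (M (last K d') <= M (last L d))%N -> C (ev d' u')) ->
  C (push K L d u ev).
Proof.
move=> C0 CN Cn; elim: d K L ev => [|L' d IH] K L ev /= KL.
  move=> _ Lu; apply => //=; first by rewrite /up KL.
  by rewrite (covers_rank KL).
case/andP=> L'L dd uu H; case: eqP => [eK|neK].
  by apply/Cn/H; rewrite -eK.
case: ifP => [cI|_]; last exact: C0.
have cI' : covers (flatI K L') L'.
  have /eqP := covers_rank KL; rewrite (covers_rank L'L) eqSS => /eqP rL'.
  by rewrite flatIC covers_flatIE flatIC rL' -covers_flatIE.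
apply: CN; apply: IH => //= d' u' dd' uu' lu rk.
by apply: H => //=; rewrite dd' andbT.
Qed.

Lemma nf_ind (C : T -> Prop) K s ev :
    C 0 -> (forall x, C x -> C (- x)) -> (forall x n, C x -> C (x *+ n)) ->
    path (@adjacent E M) K s ->
    (forall d u, path down K d -> path up (last K d) u ->
       last (last K d) u = last K s -> C (ev d u)) ->
  C (nf K s ev).
Proof.
move=> C0 CN Cn; elim: s K ev => [|L s IH] K ev /=; first by move=> _; apply.
case/andP=> aKL Ls H; apply: IH => // d u dd uu lu.
case: ifP => cLK; first by apply: H; rewrite //= [down _ _]cLK.
have cKL : covers K L by move: aKL; rewrite /adjacent cLK orbF.
by apply: push_ind => // d' u' dd' uu' lu' _; apply: H => //; rewrite lu'.
Qed.

(* [ev] vanishes on the multiples of the relations (FS). *)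
Definition down_compat K ev : Prop := forall pre Q P d u,
  path down K pre -> last K pre = P -> Q \subset P -> M P = (M Q).+2 ->
  \sum_(X | between Q P X) ev (pre ++ X :: Q :: d) u = 0.

Definition up_compat K ev : Prop := forall d pre Q P u,
  path down K d -> last (last K d) pre = Q -> Q \subset P -> M P = (M Q).+2 ->
  \sum_(X | between Q P X) ev d (pre ++ X :: P :: u) = 0.

Definition FS_compat K ev := down_compat K ev /\ up_compat K ev.

Lemma FS_cons K L ev : FS_compat K ev -> covers L K -> FS_compat L (fun d u => ev (L :: d) u).
Proof.
move=> [evd evu] LK; split=> [pre Q P d u dpre lP QP rP|d pre Q P u dd lQ QP rP].
  by apply: (evd (L :: pre)) => //=; rewrite [down _ _]LK.
by apply: evu => //=; rewrite [down _ _]LK.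
Qed.

Lemma covers_flatI_sym K K' L : covers K L -> covers K' L ->
  covers (flatI K K') K' = covers (flatI K K') K.
Proof.
move=> /covers_rank rK /covers_rank; rewrite rK => -[rK'].
by rewrite flatIC covers_flatIE flatIC -rK' -covers_flatIE.
Qed.

(** The ambiguity K <. L >. X >. Q. If Q lies in K, the term X = K carries the factor [#|L :\: K|],
    every other X meets K in Q and carries [- #|X :\: Q|], and these cancel. Otherwise the step is
    pushed twice, the signs cancel, and [sum_flatI] turns the sum into an (FS) sum between
    [flatI K Q] and K. *)
Lemma push_FSdown_nil K L ev Q d u : FS_compat K ev -> covers K L ->
  Q \subset L -> M L = (M Q).+2 ->
  \sum_(X | between Q L X) push K L (X :: Q :: d) u ev = 0.
Proof.
move=> [evd evu] KL QL rL.
have rK : M K = (M Q).+1 by have := covers_rank KL; rewrite rL => -[].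
have [QK|QK] := boolP (Q \subset K).
  have cQK : covers Q K by rewrite coversE QK rK eqxx.
  have bK : between Q L K by rewrite /between cQK.
  rewrite (bigD1 _ bK) (eq_bigr (fun X => - (ev (Q :: d) u *+ #|X :\: Q|))).
    by rewrite /= eqxx sumrN sumrMnr -card_setD_covers // subrr.
  move=> X /andP[bX XK] /=.
  have eI := flatI_below bX KL QK XK.
  by rewrite (negPf XK) eI cQK eqxx -[K :&: X]/(flat_set (flatI K X)) eI.
pose Z := flatI K Q.
pose f Y := push Z Q d u (fun d u => ev [:: Y, Z & d] u).
have tE X : between Q L X -> push K L (X :: Q :: d) u ev =
    if covers (flatI K X) K && (M Q == (M Z).+1) then f (flatI K X) else 0.
  move=> bX /=; have /andP[/covers_sub QX _] := bX.
  rewrite ifN; last by apply: contra QK => /eqP <-.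
  case: ifP => //= cI; rewrite ifN; last first.
    by apply: contra QK => /eqP ->; rewrite subsetIl.
  have -> : flatI (flatI K X) Q = Z.
    by apply: val_inj; rewrite /= -setIA (setIidPr QX).
  have -> : covers Z (flatI K X) = (M Q == (M Z).+1).
    by move: (covers_rank cI); rewrite coversE /= setIS // rK => -[->].
  by case: ifP; rewrite ?opprK ?oppr0.
rewrite (eq_bigr _ tE); have [rQ|_] := eqVneq (M Q) (M Z).+1; last first.
  by rewrite big1 // => X _; rewrite andbF.
under eq_bigr do rewrite andbT.
rewrite -big_mkcondr sum_flatI //= sum_push.
rewrite (eq_push _ _ _ _ (ev' := fun _ _ => 0)) => [|d' u']; first exact: push0.
by apply: (evd [::]) => //; rewrite ?subsetIl // rK rQ.
Qed.

(** Compatibility survives an up step on the left: the step moves along the descending part until it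
    is absorbed, vanishes, joins the ascending part, or meets the descending relation of
    [push_FSdown_nil]. *)
Lemma push_FS K L ev : FS_compat K ev -> covers K L ->
  FS_compat L (fun d u => push K L d u ev).
Proof.
move=> evFS KL; split.
  move=> pre Q P d u; elim: pre K L ev evFS KL => [|L' pre IH] K L ev evFS KL.
    by move=> _ /= <- QP rP; apply: push_FSdown_nil.
  move=> /andP[L'L dpre] lP QP rP /=; case: eqP => [e|_].
    by rewrite sumrMnl evFS.1 ?mul0rn //; rewrite -e.
  case: (boolP (covers (flatI K L') K)) => [cI|_]; last by rewrite big1.
  by rewrite sumrN (IH _ _ _ (FS_cons evFS cI)) ?oppr0 // (covers_flatI_sym KL).
move=> d pre Q P u; elim: d K L ev evFS KL => [|L' d IH] K L ev evFS KL.
  by move=> _ /= lQ QP rP; apply: (evFS.2 [::] (L :: pre)).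
move=> /andP[L'L dd] lP QP rP /=; case: eqP => [e|_].
  by rewrite sumrMnl evFS.2 ?mul0rn //; rewrite -e.
case: (boolP (covers (flatI K L') K)) => [cI|_]; last by rewrite big1.
by rewrite sumrN (IH _ _ _ (FS_cons evFS cI)) ?oppr0 // (covers_flatI_sym KL).
Qed.

(** The ambiguity L <. X <. K >. K'. If L lies in K', the counting identity applies as before.
    Otherwise both up steps pass below K', and [sum_flatI] gives the same sum with K' for K and
    [flatI K' L] for L, one step shorter. *)
Lemma push_push_sum L K ev d u : FS_compat L ev -> path down K d ->
  L \subset K -> M K = (M L).+2 ->
  \sum_(X | between L K X) push X K d u (fun d u => push L X d u ev) = 0.
Proof.
elim: d L K ev => [|K' d IH] L K ev evFS /=.
  by move=> _ LK rK; apply: (evFS.2 [::] [::]).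
case/andP=> K'K dd LK rK.
have rK' : M K' = (M L).+1 by have := covers_rank K'K; rewrite rK => -[].
have [LK'|LK'] := boolP (L \subset K').
  have cLK' : covers L K' by rewrite coversE LK' rK' eqxx.
  have bK : between L K K' by rewrite /between cLK'.
  rewrite (bigD1 _ bK) (eq_bigr (fun X => - (push L K' d u ev *+ #|X :\: L|))).
    by rewrite /= eqxx sumrN sumrMnr -card_setD_covers // subrr.
  move=> X /andP[bX XK]; have eI := flatI_below bX K'K LK' XK.
  rewrite eq_sym (negPf XK) flatIC eI; have /andP[-> _] := bX.
  by rewrite /= eqxx -push_mulrn.
pose Z := flatI K' L.
pose f Y := push Y K' d u (fun d u => push Z Y d u (fun d u => ev (Z :: d) u)).
have tE X : between L K X ->
    (if K' == X then push L X d u ev *+ #|K :\: X| else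
     if covers (flatI X K') X then
      - push (flatI X K') K' d u (fun d u => push L X (flatI X K' :: d) u ev)
     else 0) =
    if covers (flatI K' X) K' && (M L == (M Z).+1) then f (flatI K' X) else 0.
  move=> bX /=; have /andP[/covers_sub LX XK] := bX.
  rewrite ifN; last by apply: contra LK' => /eqP ->.
  rewrite -(covers_flatI_sym XK K'K) [flatI X K']flatIC; case: ifP => //= cI.
  have inner d' u' : push L X (flatI K' X :: d') u' ev =
      - (if M L == (M Z).+1 then
           push Z (flatI K' X) d' u' (fun d u => ev (Z :: d) u) else 0).
    rewrite /= ifN; last by apply: contra LK' => /eqP <-; rewrite subsetIl.
    have -> : flatI L (flatI K' X) = Z.
      by apply: val_inj; rewrite /= setIC -setIA (setIidPr LX).
    have -> : covers Z L = (M L == (M Z).+1) by rewrite coversE subsetIr.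
    by case: ifP; rewrite ?oppr0.
  rewrite (eq_push _ _ _ _ inner) pushN opprK.
  by case: ifP => _ //; rewrite push0.
rewrite (eq_bigr _ tE); have [rL|_] := eqVneq (M L) (M Z).+1; last first.
  by rewrite big1 // => X _; rewrite andbF.
under eq_bigr do rewrite andbT.
have cZ : covers Z L by rewrite coversE subsetIr rL eqxx.
rewrite -big_mkcondr sum_flatI //=.
by rewrite (IH _ _ _ (FS_cons evFS cZ)) ?subsetIl // rK' rL.
Qed.

End Fixed.
End NormalForm.

(** * Maps out of the algebra of flag paths *)

Section Pull.
Variables (E : finType) (M : matroid E) (T : zmodType).
Implicit Types (F G K L P Q X Y : flat M) (d u s : seq (flat M)).
Implicit Types ev : seq (flat M) -> seq (flat M) -> T.

(** Composition of [ev] with left multiplication by the path [(K, s)], as [nf_cat] shows; the result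
    is a function on valleys starting at [last K s]. *)
Fixpoint pull K s ev : seq (flat M) -> seq (flat M) -> T :=
  if s is L :: s' then
    pull L s' (fun d u => if covers L K then ev (L :: d) u else push K L d u ev)
  else ev.

Lemma nf_cat K s s' ev : nf K (s ++ s') ev = nf (last K s) s' (pull K s ev).
Proof. by elim: s K ev => //= L s IH K ev; rewrite IH. Qed.

Lemma FS_pull K s ev : path (@adjacent E M) K s -> FS_compat K ev ->
  FS_compat (last K s) (pull K s ev).
Proof.
elim: s K ev => //= L s IH K ev /andP[aKL Ls] evFS; apply: IH => //.
case cLK: (covers L K); first exact: FS_cons evFS cLK.
by apply: push_FS => //; move: aKL; rewrite /adjacent cLK orbF.
Qed.

Lemma nf0 K s : nf K s (fun _ _ => 0 : T) = 0.
Proof.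
elim: s K => //= L s IH K; rewrite -[RHS](IH L); apply: eq_nf => d u.
by rewrite push0 if_same.
Qed.

Lemma nfD K s ev ev' :
  nf K s ev + nf K s ev' = nf K s (fun d u => ev d u + ev' d u).
Proof.
have := sum_nf (index_enum bool) xpredT K s (fun b => if b then ev else ev').
by rewrite big_bool => ->; apply: eq_nf => d u; rewrite big_bool.
Qed.

Lemma nf_mulrn K s ev n : nf K s ev *+ n = nf K s (fun d u => ev d u *+ n).
Proof.
elim: n => [|n IH]; first by rewrite mulr0n nf0.
by rewrite mulrS IH nfD; apply: eq_nf => d u; rewrite mulrS.
Qed.

(** [push] and [nf] accept arbitrary sequences, but on a flag path they evaluate [ev] only at
    genuine valleys. *)
Lemma eq_nf_valley K s ev ev' : path (@adjacent E M) K s ->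
  (forall d u, path (@down E M) K d -> path (@up E M) (last K d) u ->
     ev d u = ev' d u) -> nf K s ev = nf K s ev'.
Proof.
move=> Ks e; have -> : nf K s ev = nf K s ev' + nf K s (fun d u => ev d u - ev' d u).
  by rewrite nfD; apply: eq_nf => d u; rewrite addrC subrK.
rewrite [X in _ + X](_ : _ = 0) ?addr0 //.
apply: (nf_ind (C := fun x => x = 0)) => // [x ->|x n ->|d u dd uu _].
- exact: oppr0.
- exact: mul0rn.
- by rewrite e // subrr.
Qed.

Lemma nf_eq0 K s ev : path (@adjacent E M) K s ->
  (forall d u, path (@down E M) K d -> ev d u = 0) -> nf K s ev = 0.
Proof.
by move=> Ks ev0; rewrite -(nf0 K s); apply: eq_nf_valley => // d u /ev0 ->.
Qed.

Lemma nf_up K u ev : path (@up E M) K u -> nf K u ev = ev [::] u.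
Proof.
elim: u K ev => //= L u IH K ev /andP[cKL uu].
by rewrite IH // (covers_asym cKL).
Qed.

Lemma pull_down K d ev d' u' : path (@down E M) K d -> pull K d ev d' u' = ev (d ++ d') u'.
Proof.
by elim: d K ev => //= L d IH K ev /andP[cLK dd]; rewrite IH // [covers _ _]cLK.
Qed.

Lemma nf_valley K d u ev : path (@down E M) K d -> path (@up E M) (last K d) u ->
  nf K (d ++ u) ev = ev d u.
Proof. by move=> dd uu; rewrite nf_cat nf_up // pull_down // cats0. Qed.

Lemma FS0 K : FS_compat K (fun _ _ => 0 : T).
Proof. by split=> pre Q P d u *; rewrite big1. Qed.
End Pull.

Lemma push_morph (E : finType) (M : matroid E) (T T' : zmodType) (h : T -> T')
    (K L : flat M) d u ev :
  zmod_morphism h -> h (push K L d u ev) = push K L d u (fun d u => h (ev d u)).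
Proof.
move=> hB.
pose H := HB.pack_for {additive T -> T'} h (GRing.isZmodMorphism.Build T T' h hB).
have h0 : h 0 = 0 := raddf0 H; have hN x : h (- x) = - h x := raddfN H x.
have hMn x n : h (x *+ n) = h x *+ n := raddfMn H n x.
elim: d K L ev => //= L' d IH K L ev; case: ifP => _; first by rewrite hMn.
by case: ifP => _; [rewrite hN IH | rewrite h0].
Qed.

Lemma nf_morph (E : finType) (M : matroid E) (T T' : zmodType) (h : T -> T')
    (K : flat M) s ev :
  zmod_morphism h -> h (nf K s ev) = nf K s (fun d u => h (ev d u)).
Proof.
move=> hB; elim: s K ev => //= L s IH K ev; rewrite IH; apply: eq_nf => d u.
by case: ifP => // _; rewrite push_morph.
Qed.

(** * Descent of compatible functions to $S(M)$ *)

Section Lift.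
Variables (E : finType) (M : matroid E) (T : zmodType).
Implicit Types (F G K L P Q X Y : flat M) (d u s : seq (flat M)).
Implicit Types ev : flat M -> seq (flat M) -> seq (flat M) -> T.
Local Notation A := (flag_alg M).

Definition flag_lift ev (x : A) : zmodule T :=
  free_lift (X := zmodule T)
    (fun p : flag_path M => nf (fstart p) (flag_seq p).2 (ev (fstart p))) x.

Lemma flag_liftE ev K s : path (@adjacent E M) K s ->
  flag_lift ev (fpath K s) = nf K s (ev K).
Proof.
move=> Ks; pose p := FlagPath (Ks : is_flag_path (K, s)).
by rewrite /flag_lift -[fpath K s]/(fpath (fstart p) (flag_seq p).2) fpathE free_liftU.
Qed.

Lemma flag_alg_ind (C : A -> Prop) :
    C 0 -> (forall x y, C x -> C y -> C (x + y)) -> (forall x, C x -> C (- x)) ->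
    (forall K s, path (@adjacent E M) K s -> C (fpath K s)) -> forall x, C x.
Proof.
move=> C0 CD CN Cp.
have Cn x n : C x -> C (x *+ n).
  by move=> Cx; elim: n => [|n IH]; rewrite ?mulr0n // mulrS; apply: CD.
elim/malg_ind => // a p x Cx; apply: (CD) => //.
have Cb : C << p >> by rewrite -fpathE; case: p => [[K s] Ks]; apply: Cp.
have -> : a *: << p >> = (<< p >> : A) *~ a by rewrite -scaler_int intz.
by case: a => n; [apply: (Cn) | apply/CN/(Cn _ n.+1)].
Qed.

Lemma flag_lift_is_linear ev : linear (flag_lift ev).
Proof. by move=> n x y; rewrite /flag_lift linearP. Qed.
HB.instance Definition _ ev := GRing.isLinear.Build int A (zmodule T) *:%R
  (flag_lift ev) (flag_lift_is_linear ev).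

Lemma flag_lift_pathM ev K s (x : A) : path (@adjacent E M) K s ->
  flag_lift ev (fpath K s * x) =
  flag_lift (fun L => if L == last K s then pull K s (ev K) else fun _ _ => 0) x.
Proof.
move=> Ks; elim/flag_alg_ind: x => [|x y IHx IHy|x IH|L s' Ls'].
- by rewrite mulr0 !linear0.
- by rewrite mulrDr !linearD /= IHx IHy.
- by rewrite mulrN !linearN /= IH.
rewrite flag_liftE // -[_ * _]/(fmul _ _) fpathM // [L == _]eq_sym.
case: eqP => [e|_]; last by rewrite linear0 nf0.
by rewrite flag_liftE ?nf_cat ?e // cat_path Ks e.
Qed.

(** Quantifying over [y] makes this a right ideal; quantifying over [ev] makes it a left ideal,
    since left multiplication by a path replaces [ev] by its [pull], again compatible by
    [FS_pull]. *)
Definition lift_ker : {pred A} := fun x => `[< forall ev,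
  (forall K, FS_compat K (ev K)) -> forall y, flag_lift ev (x * y) = 0 >].

Lemma lift_ker_zmod : zmod_closed lift_ker.
Proof.
split; first by apply/asboolP => ev _ y; rewrite mul0r linear0.
move=> x x' /asboolP x0 /asboolP x0'; apply/asboolP => ev evFS y.
by rewrite mulrBl linearB /= x0 // x0' // subrr.
Qed.

Lemma lift_ker_two_sided : two_sided lift_ker.
Proof.
move=> a x /asboolP x0; split; apply/asboolP => ev evFS y; last first.
  by rewrite -mulrA x0.
elim/flag_alg_ind: a => [|a b IHa IHb|a IH|K s Ks].
- by rewrite !mul0r linear0.
- by rewrite !mulrDl linearD /= IHa IHb addr0.
- by rewrite !mulNr linearN /= IH oppr0.
rewrite -mulrA flag_lift_pathM // x0 // => L; case: eqP => [->|_]; last exact: FS0.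
exact: FS_pull.
Qed.

HB.instance Definition _ := GRing.isZmodClosed.Build A lift_ker lift_ker_zmod.
HB.instance Definition _ := isTwoSided.Build A lift_ker lift_ker_two_sided.

Lemma fpathM_lift ev K s L s' : path (@adjacent E M) K s -> path (@adjacent E M) L s' ->
  flag_lift ev (fpath K s * fpath L s') = if last K s == L then nf K (s ++ s') (ev K) else 0.
Proof.
move=> Ks Ls; rewrite -[_ * _]/(fmul _ _) fpathM //.
case: eqP => [e|_]; last by rewrite linear0.
by rewrite flag_liftE // cat_path Ks e.
Qed.

Lemma adj_down K L : covers L K -> adjacent K L.
Proof. by rewrite /adjacent => ->; rewrite orbT. Qed.

Lemma adj_up K L : covers K L -> adjacent K L.
Proof. by rewrite /adjacent => ->. Qed.

(** The meet relations hold because they are the reduction rules, the descending (FS) by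
    compatibility of [ev] itself, and the ascending (FS) by [push_push_sum]. It suffices to test [y]
    on paths. *)
Lemma relation_lift_ker x : flag_relation x -> x \in lift_ker.
Proof.
move=> relx; apply/asboolP => ev evFS y.
elim/flag_alg_ind: y => [|y z IHy IHz|y IH|J s Js].
- by rewrite mulr0 linear0.
- by rewrite mulrDr linearD /= IHy IHz addr0.
- by rewrite mulrN linearN /= IH oppr0.
case: relx => [L K LK rK|L K LK rK|K L KL|K K' L KL K'L neq cI|K K' L KL K'L neq cI].
- have rK' : M K = (M L).+2 by rewrite rK addn2.
  rewrite mulr_suml linear_sum /=.
  rewrite (eq_bigr (fun X => if K == J then nf K s
    (fun d u => push X K d u (fun d u => push L X d u (ev L))) else 0)); last first.
    move=> X /andP[LX XK].
    rewrite fpathM_lift //=; last by rewrite !adj_up.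
    by rewrite (covers_asym LX) (covers_asym XK).
  case: eqP => [eJ|_]; last by rewrite big1.
  subst J; rewrite sum_nf nf_eq0 // => d u dd.
  exact: push_push_sum (evFS L) dd (proper_sub LK) rK'.
- have rK' : M K = (M L).+2 by rewrite rK addn2.
  rewrite mulr_suml linear_sum /=.
  rewrite (eq_bigr (fun X => if L == J then nf L s
    (fun d u => ev K [:: X, L & d] u) else 0)); last first.
    move=> X /andP[LX XK].
    rewrite fpathM_lift //=; last by rewrite !adj_down.
    by rewrite LX XK.
  case: eqP => [eJ|_]; last by rewrite big1.
  subst J; rewrite sum_nf nf_eq0 // => d u dd.
  by apply: ((evFS K).1 [::]) => //; apply: proper_sub.
- rewrite mulrBl linearB mulrnAl linearMn /= !fpathM_lift //=; last first.
    by rewrite adj_up // adj_down.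
  case: eqP => [eJ|_]; last by rewrite mul0rn subr0.
  subst J; rewrite -[LHS]/(nf K s _ - nf K s (ev K) *+ _ : T) nf_mulrn.
  rewrite [X in X - _](@eq_nf _ _ T K s _ (fun d u => ev K d u *+ #|L :\: K|)) ?subrr //.
  by move=> d u; rewrite KL (covers_asym KL) eqxx.
- have cI' : covers (flatI K K') K' by rewrite (covers_flatI_sym KL).
  rewrite mulrBl linearB mulNr linearN /= !fpathM_lift //=; last 2 first.
  + by rewrite adj_down // adj_up.
  + by rewrite adj_up // adj_down.
  case: eqP => [eJ|_]; last by rewrite oppr0 subr0.
  subst J; rewrite opprK -[LHS]/(nf K' s _ + nf K' s _ : T) nfD nf_eq0 // => d u _.
  rewrite K'L (covers_asym KL) eq_sym (negPf neq) cI (covers_asym cI') /=.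
  by rewrite addNr.
rewrite fpathM_lift //=; last by rewrite adj_up // adj_down.
case: eqP => [eJ|_] //; subst J; rewrite nf_eq0 // => d u _.
by rewrite K'L (covers_asym KL) eq_sym (negPf neq) (negPf cI).
Qed.

Definition schur_lift ev (a : schur M) : zmodule T :=
  flag_lift ev (repr (a : Quotient.quot (@flag_ideal E M))).

Lemma schur_liftE ev x : (forall K, FS_compat K (ev K)) ->
  schur_lift ev (rpi (@flag_ideal E M) x) = flag_lift ev x.
Proof.
move=> evFS; apply/eqP; rewrite -subr_eq0 /schur_lift -linearB; apply/eqP.
have : repr (rpi (@flag_ideal E M) x : Quotient.quot (@flag_ideal E M)) - x
    \in @flag_ideal E M.
  by apply/rpi_eqE; rewrite /rpi reprK.
move/(gen_ideal_min (J := lift_ker) relation_lift_ker)/asboolP/(_ ev evFS 1).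
by rewrite mulr1.
Qed.

Lemma schur_lift_zmod ev : (forall K, FS_compat K (ev K)) -> zmod_morphism (schur_lift ev).
Proof.
move=> evFS a b; have [x ->] := rpi_surj a; have [y ->] := rpi_surj b.
by rewrite -raddfB !schur_liftE // linearB.
Qed.

End Lift.

(** * Extension of scalars, and spanning by valleys *)

Section Schur.
Variables (E : finType) (M : matroid E) (k : comNzRingType).
Implicit Types (F G K L P Q X Y : flat M) (d u s : seq (flat M)).

Definition schur_of (x : flag_alg M) : schur_over k M := bpure (rpi (@flag_ideal E M) x) 1.

Lemma schur_of_zmod : zmod_morphism schur_of.
Proof.
move=> x y; rewrite /schur_of raddfB; apply: (addIr (schur_of y)).
by rewrite subrK -[LHS]bpureDl subrK.
Qed.
HB.instance Definition _ := GRing.isZmodMorphism.Build (flag_alg M) (schur_over k M)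
  schur_of schur_of_zmod.

Lemma schur_of_monoid : monoid_morphism schur_of.
Proof.
split=> [|x y]; first by rewrite /schur_of rmorph1.
rewrite /schur_of -[RHS]/((_ : base_change _ _) * _) bpureM mulr1 -rmorphM.
by [].
Qed.
HB.instance Definition _ := GRing.isMonoidMorphism.Build (flag_alg M) (schur_over k M)
  schur_of schur_of_monoid.

Lemma schur_of_rel x : flag_relation x -> schur_of x = 0.
Proof.
move=> relx; have -> : schur_of x = schur_of 0; last exact: raddf0.
by congr bpure; apply/rpi_eqE; rewrite subr0; apply: mem_gen_ideal.
Qed.

Definition sp K s : schur_over k M := schur_of (fpath K s).

Lemma schur_over_ind (C : schur_over k M -> Prop) :
    C 0 -> (forall a x y, C x -> C y -> C (a *: x + y)) ->
    (forall K s, path (@adjacent E M) K s -> C (sp K s)) -> forall x, C x.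
Proof.
move=> C0 CL Cp.
have CD x y : C x -> C y -> C (x + y) by move=> Cx Cy; rewrite -[x]scale1r; apply: CL.
elim/base_change_ind => // a c x Cx.
have [y ->] := rpi_surj a.
have -> : bpure (rpi (@flag_ideal E M) y) c = c *: schur_of y.
  rewrite -[RHS]/(c *: (bpure _ 1 : base_change _ _)) bscaleE.
  by rewrite mulr1.
apply: (CL) => //; elim/flag_alg_ind: y => [|y z Cy Cz|y Cy|K s Ks].
- by rewrite raddf0.
- by rewrite raddfD; apply: CD.
- by rewrite raddfN -scaleN1r -[_ *: _]addr0; apply: CL.
- exact: Cp.
Qed.

(* The universal property of [S_k(M)]: compatibility with (FS) on normal forms
   is the only condition. *)
Lemma schur_over_lift (T : lmodType k) (ev : flat M -> seq (flat M) -> seq (flat M) -> T) :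
  (forall K, FS_compat K (ev K)) ->
  exists2 Psi : schur_over k M -> T, linear Psi &
    forall K s, path (@adjacent E M) K s -> Psi (sp K s) = nf K s (ev K).
Proof.
move=> evFS.
pose f (a : schur M) (c : k) : zmodule T := c *: (schur_lift ev a : T).
have fB1 a : zmod_morphism (f a) by move=> c d; rewrite /f scalerBl.
have fB2 c : zmod_morphism (f^~ c).
  by move=> a b; rewrite /f schur_lift_zmod // scalerBr.
pose Psi (x : schur_over k M) : T := base_change_lift f x.
have PsiE a c : Psi (bpure a c) = c *: (schur_lift ev a : T).
  exact: base_change_liftE fB1 fB2 a c.
have PsiB : zmod_morphism Psi := base_change_lift_zmod_morphism fB1 fB2.
have Psi0 : Psi 0 = 0 by have := PsiB 0 0; rewrite !subrr.
have PsiD x y : Psi (x + y) = Psi x + Psi y.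
  by rewrite -{1}[y]opprK PsiB -[- y]sub0r PsiB Psi0 sub0r opprK.
exists Psi => [c x y|K s Ks].
  rewrite PsiD; congr (_ + _); elim/base_change_ind: x => [|a d x IH].
    by rewrite scaler0 Psi0 scaler0.
  rewrite scalerDr !PsiD IH scalerDr; congr (_ + _).
  rewrite -[c *: bpure a d]/(c *: (bpure a d : base_change _ _)) bscaleE.
  by rewrite !PsiE scalerA.
by rewrite PsiE scale1r schur_liftE // flag_liftE.
Qed.

Lemma sp_valley_lift (T : lmodType k) (ev : flat M -> seq (flat M) -> seq (flat M) -> T) :
  (forall K, FS_compat K (ev K)) ->
  exists2 Psi : schur_over k M -> T, linear Psi &
    forall K d u, path (@down E M) K d -> path (@up E M) (last K d) u ->
      Psi (sp K (d ++ u)) = ev K d u.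
Proof.
case/schur_over_lift => Psi Psil PsiE; exists Psi => // K d u dd uu.
rewrite PsiE ?nf_valley // cat_path.
by rewrite (sub_path _ dd) ?(sub_path _ uu) // => [X Y /adj_up|X Y /adj_down].
Qed.

Lemma sp_nopath K s : ~~ path (@adjacent E M) K s -> sp K s = 0.
Proof. by move=> Ks; rewrite /sp /fpath insubN ?raddf0. Qed.

Lemma spM K s L s' : sp K s * sp L s' = if last K s == L then sp K (s ++ s') else 0.
Proof.
have [Ks|Ks] := boolP (path (@adjacent E M) K s); last first.
  by rewrite (sp_nopath Ks) mul0r sp_nopath ?if_same // cat_path (negPf Ks).
have [Ls|Ls] := boolP (path (@adjacent E M) L s'); last first.
  rewrite (sp_nopath Ls) mulr0; case: eqP => // eL.
  by rewrite sp_nopath // cat_path eL (negPf Ls) andbF.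
rewrite /sp -rmorphM -[fpath K s * _]/(fmul _ _) fpathM //.
by case: ifP => // _; rewrite rmorph0.
Qed.

Lemma sp_cat K s s' : sp K (s ++ s') = sp K s * sp (last K s) s'.
Proof. by rewrite spM eqxx. Qed.

Lemma sp_cons K L s : sp K (L :: s) = sp K [:: L] * sp L s.
Proof. exact: (sp_cat K [:: L]). Qed.

Lemma adjacent_valley K d u : path (@down E M) K d -> path (@up E M) (last K d) u ->
  path (@adjacent E M) K (d ++ u).
Proof.
move=> dd uu; rewrite cat_path.
by rewrite (sub_path _ dd) ?(sub_path _ uu) // => [X Y /adj_up|X Y /adj_down].
Qed.

Lemma mulr_zmod (R : pzRingType) (a : R) : zmod_morphism ( *%R a).
Proof. by move=> x y; rewrite mulrBr. Qed.

(** Each branch of [push] applies one of the meet relations, so in the quotient a reduction step is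
    an equality. Iterating gives [sp_nf], hence the spanning by valleys. *)
Lemma sp_push K L d u : covers K L -> path (@down E M) L d -> path (@up E M) (last L d) u ->
  sp K [:: L] * sp L (d ++ u) = push K L d u (fun d u => sp K (d ++ u)).
Proof.
move=> KL dd uu; have KL' : path (@adjacent E M) K [:: L] by rewrite /= adj_up.
elim: d K L KL KL' dd uu => [|L' d IH] K L KL KL' /=.
  by rewrite -sp_cons.
move=> /andP[L'L dd] uu; have aL := adj_down L'L.
have Ld := adjacent_valley dd uu.
have -> : sp K [:: L] * sp L (L' :: d ++ u) = sp K [:: L; L'] * sp L' (d ++ u).
  by rewrite !spM !eqxx.
case: eqP => [e|/eqP neq].
  subst L'; have := schur_of_rel (MeetEq KL).
  rewrite raddfB raddfMn /= -!/(sp _ _) => /eqP; rewrite subr_eq0 => /eqP ->.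
  by rewrite mulrnAl spM eqxx.
case: ifPn => [cI|ncI].
  have cI' : covers (flatI K L') L' by rewrite (covers_flatI_sym KL).
  rewrite eq_sym in neq.
  have := schur_of_rel (MeetNeq KL L'L neq cI).
  rewrite raddfB raddfN /= -!/(sp _ _) => /eqP; rewrite subr_eq0 => /eqP ->.
  have aI : path (@adjacent E M) (flatI K L') [:: L'] by rewrite /= adj_up.
  rewrite mulNr; congr (- _).
  rewrite sp_cons -mulrA (IH _ _ cI' aI) // (push_morph _ _ _ _ _ (mulr_zmod _)).
  by apply: eq_push => d' u' /=; rewrite -sp_cons.
by rewrite eq_sym in neq; rewrite [sp K _](schur_of_rel (MeetZero KL L'L neq ncI)) mul0r.
Qed.

Lemma sp_nf K s : path (@adjacent E M) K s ->
  sp K s = nf K s (fun d u => sp K (d ++ u)).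
Proof.
elim: s K => //= L s IH K /andP[aKL Ls].
rewrite sp_cons // IH // (nf_morph _ _ _ (mulr_zmod _)).
apply: eq_nf_valley => // d u dd uu.
case cLK: (covers L K); first by rewrite -sp_cons.
by apply: sp_push => //; move: aKL; rewrite /adjacent cLK orbF.
Qed.

End Schur.

(** * Triangular decomposition *)

Section Span.
Variables (R : pzRingType) (V : lmodType R).

Lemma gen_submod_ind (G : V -> Prop) (C : V -> Prop) :
    C 0 -> (forall a x y, C x -> C y -> C (a *: x + y)) -> (forall x, G x -> C x) ->
  forall x, x \in gen_submod G -> C x.
Proof.
move=> C0 CL CG x /asboolP xG.
pose S : {pred V} := fun x => `[< C x >].
have Sc : submod_closed S.
  split; first exact/asboolP.
  by move=> a y z /asboolP Cy /asboolP Cz; apply/asboolP/CL.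
pose S' := HB.pack_for (submodClosed V) (S : V -> bool)
  (GRing.isSubmodClosed.Build R V S Sc).
by have /asboolP := xG S' (fun g Gg => asboolT (CG g Gg)).
Qed.

(** Serves maps such as [to_subspace], which are linear on a submodule but have a default value
    outside it. *)
Lemma sum_on_submod (T : lmodType R) (U : submodClosed V) (h : V -> T) (I : Type)
    (r : seq I) (C : pred I) (x : I -> V) :
    (forall a x y, x \in U -> y \in U -> h (a *: x + y) = a *: h x + h y) ->
    (forall i, C i -> x i \in U) ->
  h (\sum_(i <- r | C i) x i) = \sum_(i <- r | C i) h (x i).
Proof.
move=> hL xU; suff [] : h (\sum_(i <- r | C i) x i) = \sum_(i <- r | C i) h (x i) /\
  \sum_(i <- r | C i) x i \in U by [].
elim/big_rec2: _ => [|i y z Ci [<- yU]].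
  by have := hL (-1) 0 0 (rpred0 U) (rpred0 U); rewrite scaler0 addr0 scaleN1r addNr rpred0.
by split; [have := hL 1 _ _ (xU _ Ci) yU; rewrite !scale1r | rewrite rpredD ?xU].
Qed.

End Span.

Section Basics.
Variables (E : finType) (M : matroid E).
Implicit Types (F G K L P Q X Y : flat M) (d u s : seq (flat M)).

Lemma rank_down K d : path (@down E M) K d -> (M (last K d) + size d = M K)%N.
Proof.
elim: d K => [|L d IH] K /=; first by rewrite addn0.
by case/andP=> /covers_rank -> /IH <-; rewrite addnS.
Qed.

Lemma rank_up K u : path (@up E M) K u -> (M K + size u = M (last K u))%N.
Proof.
elim: u K => [|L u IH] K /=; first by rewrite addn0.
by case/andP=> /covers_rank e /IH <-; rewrite e addnS addSn.
Qed.

End Basics.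

(* The properties of [S_k(M)] used from here on, [sp K s] being the class of the
   flag path [(K, s)].  Working with an arbitrary such algebra keeps conversion
   away from the quotient and tensor product defining [S_k(M)]. *)
Record flag_presentation (E : finType) (M : matroid E) (k : fieldType) (A : algType k)
    (sp : flat M -> seq (flat M) -> A) : Prop := {
  fp_mul : forall K s L s',
    sp K s * sp L s' = if last K s == L then sp K (s ++ s') else 0;
  fp_one : \sum_F sp F [::] = 1;
  fp_ind : forall C : A -> Prop,
    C 0 -> (forall a x y, C x -> C y -> C (a *: x + y)) ->
    (forall K s, path (@adjacent E M) K s -> C (sp K s)) -> forall x, C x;
  fp_nf : forall K s, path (@adjacent E M) K s ->
    sp K s = nf K s (fun d u => sp K (d ++ u));
  fp_down : forall Q P : flat M, Q \subset P -> M P = (M Q).+2 ->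
    \sum_(X | between Q P X) sp P [:: X; Q] = 0;
  fp_up : forall Q P : flat M, Q \subset P -> M P = (M Q).+2 ->
    \sum_(X | between Q P X) sp Q [:: X; P] = 0;
  fp_lift : forall (T : lmodType k) (ev : flat M -> seq (flat M) -> seq (flat M) -> T),
    (forall K, FS_compat K (ev K)) ->
    exists2 Psi : A -> T, linear Psi &
      forall K d u, path (@down E M) K d -> path (@up E M) (last K d) u ->
        Psi (sp K (d ++ u)) = ev K d u
}.

Lemma schur_presentation (E : finType) (M : matroid E) (k : fieldType) :
  flag_presentation (A := schur_over k M) (@sp E M k).
Proof.
split.
- exact: spM.
- have -> : \sum_F sp k F [::] = schur_of k (\sum_(F : flat M) fpath F [::]).
    by rewrite raddf_sum.
  by rewrite -[X in schur_of _ X]/(1 : flag_alg M) rmorph1.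
- exact: schur_over_ind.
- exact: sp_nf.
- move=> Q P QP rP; rewrite -raddf_sum; apply: schur_of_rel.
  apply: FSdown; last by rewrite rP addn2.
  by rewrite properE QP; apply/negP => /(mrank_mono M); rewrite rP ltnNge leqnSn.
- move=> Q P QP rP; rewrite -raddf_sum; apply: schur_of_rel.
  apply: FSup; last by rewrite rP addn2.
  by rewrite properE QP; apply/negP => /(mrank_mono M); rewrite rP ltnNge leqnSn.
exact: sp_valley_lift.
Qed.

Section Reedy.
Variables (E : finType) (M : matroid E) (k : fieldType) (A : algType k).
Variables (sp : flat M -> seq (flat M) -> A) (spP : flag_presentation sp).
Implicit Types (F G K L P Q X Y : flat M) (d u s : seq (flat M)) (r : rel (flat M)).
Local Notation e := (fun F => sp F [::]).
Let spM := fp_mul spP.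

Lemma sp_catE K s s' : sp K (s ++ s') = sp K s * sp (last K s) s'.
Proof. by rewrite spM eqxx. Qed.

Lemma idem_sp F K s : sp F [::] * sp K s = if F == K then sp K s else 0.
Proof. by rewrite spM /=; case: eqP => [->|]. Qed.

Lemma sp_idem F K s : sp K s * sp F [::] = if last K s == F then sp K s else 0.
Proof. by rewrite spM cats0. Qed.

Lemma flat_idem_complete : complete_orthogonal_idempotents e.
Proof.
split=> [i j|]; first by rewrite idem_sp; case: eqP => // ->.
exact: fp_one spP.
Qed.

Definition path_span r : {pred A} :=
  gen_submod (fun x : A => exists K s, path r K s /\ x = sp K s).

Lemma mem_path_span r K s : path r K s -> sp K s \in path_span r.
Proof. by move=> Ks; apply: mem_gen_submod; exists K, s. Qed.

Lemma path_span_closed r : subalg_closed (path_span r).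
Proof.
have spanP : submod_closed (path_span r) by apply: gen_submod_closed.
split; last 1 first.
- move=> x y xr yr; move: x xr; apply: gen_submod_ind.
  + by rewrite mul0r; case: spanP.
  + by move=> a x x' Hx Hx'; rewrite mulrDl -scalerAl; apply: spanP.2.
  move=> _ [K [s [Ks ->]]]; move: y yr; apply: gen_submod_ind.
  + by rewrite mulr0; case: spanP.
  + by move=> a y y' Hy Hy'; rewrite mulrDr -scalerAr; apply: spanP.2.
  move=> _ [L [t [Lt ->]]]; rewrite spM; case: eqP => [eL|_]; last by case: spanP.
  by apply: mem_path_span; rewrite cat_path Ks eL.
- rewrite -flat_idem_complete.2.
  elim/big_rec: _ => [|F x _ Hx]; first by case: spanP.
  by rewrite -[sp F _]scale1r; apply: spanP.2 => //; apply: mem_path_span.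
exact: spanP.2.
Qed.

Definition path_subalg r : subalgClosed A :=
  HB.pack_for (subalgClosed A) (path_span r : A -> bool)
    (GRing.isSubalgClosed.Build k A (path_span r) (path_span_closed r)).

Local Notation span := path_subalg.

Lemma corner_ind r j l (C : A -> Prop) :
    C 0 -> (forall a x y, C x -> C y -> C (a *: x + y)) ->
    (forall s, path r j s -> last j s = l -> C (sp j s)) ->
  forall x, x \in corner (e j) (span r) (e l) -> C x.
Proof.
move=> C0 CL Cs _ /asboolP[x xr ->]; move: x xr; apply: gen_submod_ind => [|a x y Cx Cy|].
- by rewrite mulr0 mul0r.
- by rewrite mulrDr mulrDl -scalerAr -scalerAl; apply: CL.
move=> _ [K [s [Ks ->]]]; rewrite idem_sp; case: eqP => [eK|_]; last by rewrite mul0r.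
by rewrite sp_idem; case: eqP => // lK; subst K; apply: Cs.
Qed.

Lemma mem_corner r j s : path r j s -> sp j s \in corner (e j) (span r) (e (last j s)).
Proof.
move=> js; apply/asboolP; exists (sp j s); first exact: mem_path_span.
by rewrite idem_sp eqxx sp_idem eqxx.
Qed.

Lemma sum_down_sp K pre P Q d : last K pre = P -> Q \subset P -> M P = (M Q).+2 ->
  \sum_(X | between Q P X) sp K (pre ++ [:: X, Q & d]) = 0.
Proof.
move=> lP QP rP.
rewrite (eq_bigr (fun X => sp K pre * sp P [:: X; Q] * sp Q d)) => [|X _].
  by rewrite -mulr_suml -mulr_sumr (fp_down spP) // mulr0 mul0r.
by rewrite sp_catE lP -mulrA (sp_catE _ [:: X; Q]).
Qed.

Lemma sum_up_sp K pre Q P u : last K pre = Q -> Q \subset P -> M P = (M Q).+2 ->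
  \sum_(X | between Q P X) sp K (pre ++ [:: X, P & u]) = 0.
Proof.
move=> lQ QP rP.
rewrite (eq_bigr (fun X => sp K pre * sp Q [:: X; P] * sp P u)) => [|X _].
  by rewrite -mulr_suml -mulr_sumr (fp_up spP) // mulr0 mul0r.
by rewrite sp_catE lQ -mulrA (sp_catE _ [:: X; P]).
Qed.

(* A bilinear map on down paths into [l] and up paths out of [l] extends to
   [S_k(M)], by zero on the valleys whose bottom is not [l]. *)
Lemma bilinear_lift (T : lmodType k) l (cK cI : pred (flat M)) (D U : submodClosed A)
    (B : A -> A -> T) :
    (forall K d, cK K -> path (@down E M) K d -> last K d = l -> sp K d \in D) ->
    (forall u, cI (last l u) -> path (@up E M) l u -> sp l u \in U) ->
    (forall y, y \in U -> forall a x x', x \in D -> x' \in D ->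
       B (a *: x + x') y = a *: B x y + B x' y) ->
    (forall x, x \in D -> forall a y y', y \in U -> y' \in U ->
       B x (a *: y + y') = a *: B x y + B x y') ->
  exists2 Psi : A -> T, linear Psi &
    forall j l' i x y, x \in corner (e j) (span (@down E M)) (e l') ->
      y \in corner (e l') (span (@up E M)) (e i) ->
      Psi (x * y) = if [&& cK j, l' == l & cI i] then B x y else 0.
Proof.
move=> spD spU Bl Br.
have B0l y : y \in U -> B 0 y = 0.
  move=> yU; have := Bl y yU (-1) 0 0 (rpred0 D) (rpred0 D).
  by rewrite scaler0 addr0 scaleN1r addNr.
have B0r x : x \in D -> B x 0 = 0.
  move=> xD; have := Br x xD (-1) 0 0 (rpred0 U) (rpred0 U).
  by rewrite scaler0 addr0 scaleN1r addNr.
(* Compatibility also concerns tails [d] and [u] that are not paths, so the path conditions are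
   tested explicitly and the value is 0 when they fail. *)
pose ev K d u : T := if [&& cK K, path (@down E M) K d, last K d == l,
    cI (last l u) & path (@up E M) l u] then B (sp K d) (sp l u) else 0.
have evFS K : FS_compat K (ev K).
  split=> [pre Q P d u dpre lP QP rP|d pre Q P u dd lQ QP rP].
    pose b := [&& cK K, path (@down E M) Q d, last Q d == l, cI (last l u) &
      path (@up E M) l u].
    have cE X : between Q P X -> [&& cK K, path (@down E M) K (pre ++ [:: X, Q & d]),
        last K (pre ++ [:: X, Q & d]) == l, cI (last l u) & path (@up E M) l u] = b.
      case/andP=> QX XP; rewrite cat_path dpre /= lP last_cat /=.
      by rewrite [down _ _]XP [down _ _]QX.
    rewrite (eq_bigr (fun X => if b then B (sp K (pre ++ [:: X, Q & d])) (sp l u) else 0)).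
      case: (boolP b) => [bT|_]; last by rewrite big1.
      have /and5P[cKK Qd /eqP lQ cIu lu] := bT.
      rewrite -(sum_on_submod (U := D) (h := fun x => B x (sp l u))).
      - by rewrite sum_down_sp // B0l // spU.
      - by apply: Bl; apply: spU.
      move=> X bX; apply: spD => //; last by rewrite last_cat.
      by move: bT; rewrite -(cE _ bX) => /and5P[].
    by move=> X bX; rewrite /ev cE.
  pose b := [&& cK K, path (@down E M) K d, last K d == l, cI (last P u) &
     path (@up E M) l pre && path (@up E M) P u].
  have [lK|lK] := eqVneq (last K d) l; last first.
    by rewrite big1 // => X _; rewrite /ev (negPf lK) !andbF.
  rewrite lK in lQ.
  have cE X : between Q P X -> [&& cK K, path (@down E M) K d,
      last K d == l, cI (last l (pre ++ [:: X, P & u])) &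
      path (@up E M) l (pre ++ [:: X, P & u])] = b.
    case/andP=> QX XP; rewrite /b lK cat_path /= lQ last_cat /=.
    by rewrite [up Q X]QX [up X P]XP.
  rewrite (eq_bigr (fun X => if b then B (sp K d) (sp l (pre ++ [:: X, P & u])) else 0)).
    case: (boolP b) => [bT|_]; last by rewrite big1.
    have /and5P[cKK _ _ cIu lu] := bT.
    rewrite -(sum_on_submod (U := U) (h := B (sp K d))).
    - by rewrite sum_up_sp // B0r // spD.
    - by apply: Br; apply: spD.
    move=> X bX; move: bT; rewrite -(cE _ bX) => /and5P[_ _ _ cu pu].
    exact: spU.
  by move=> X bX; rewrite /ev cE.
have [Psi Psil PsiE] := fp_lift spP evFS.
have Psi0 : Psi 0 = 0.
  by have := Psil (-1) 0 0; rewrite scaler0 addr0 scaleN1r addNr.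
have PsiV K d u : path (@down E M) K d -> path (@up E M) (last K d) u ->
    Psi (sp K (d ++ u)) =
    if [&& cK K, last K d == l & cI (last l u)] then B (sp K d) (sp l u) else 0.
  move=> dd uu; rewrite PsiE // /ev dd /=.
  by case: eqP => [el|]; rewrite ?andbF //= -el uu andbT.
exists Psi => // j l' i x y xD yU.
case: (boolP [&& cK j, l' == l & cI i]) => [/and3P[cj /eqP el ci]|cN]; last first.
  move: x xD; apply: corner_ind => [|a x x' Hx Hx'|d dd ld].
  - by rewrite mul0r.
  - by rewrite mulrDl -scalerAl Psil Hx Hx' scaler0 addr0.
  move: y yU; apply: corner_ind => [|a y y' Hy Hy'|u uu lu].
  - by rewrite mulr0.
  - by rewrite mulrDr -scalerAr Psil Hy Hy' scaler0 addr0.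
  rewrite -ld -sp_catE PsiV ?ld // ifN //; apply: contra cN => /and3P[-> /eqP el].
  by rewrite el eqxx -lu el.
(* Membership in [D] is carried through the induction because [B] is linear in its first argument
   only there. *)
subst l'; suff [] : x \in D /\ Psi (x * y) = B x y by [].
have yU' : y \in U.
  move: y yU; apply: corner_ind => [|a y y' Hy Hy'|u uu lu].
  - exact: rpred0.
  - by rewrite rpredD // rpredZ.
  - by apply: spU; rewrite ?lu.
move: x xD; apply: corner_ind => [|a x x' [xD Hx] [xD' Hx']|d dd ld].
- by rewrite rpred0 mul0r Psi0 B0l.
- by rewrite rpredD ?rpredZ // mulrDl -scalerAl Psil Hx Hx' Bl.
have dD : sp j d \in D by apply: spD.
split=> //; suff [] : y \in U /\ Psi (sp j d * y) = B (sp j d) y by [].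
move: y yU {yU'}; apply: corner_ind => [|a y y' [yU Hy] [yU' Hy']|u uu lu].
- by rewrite rpred0 mulr0 Psi0 B0r.
- by rewrite rpredD ?rpredZ // mulrDr -scalerAr Psil Hy Hy' Br.
split; first by apply: spU; rewrite ?lu.
by rewrite -{1}ld -sp_catE PsiV ?ld // cj eqxx lu ci.
Qed.

Lemma corner_valley_ind j i (C : A -> Prop) :
    C 0 -> (forall a x y, C x -> C y -> C (a *: x + y)) ->
    (forall d u, path (@down E M) j d -> path (@up E M) (last j d) u ->
       last (last j d) u = i -> C (sp j (d ++ u))) ->
  forall x, x \in corner (e j) predT (e i) -> C x.
Proof.
move=> C0 CL Cv _ /asboolP[x _ ->].
have CN x' : C x' -> C (- x').
  by move=> Cx; rewrite -scaleN1r -[_ *: _]addr0; apply: CL.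
elim/(fp_ind spP): x => [|a x y Cx Cy|K s Ks].
- by rewrite mulr0 mul0r.
- by rewrite mulrDr mulrDl -scalerAr -scalerAl; apply: CL.
rewrite idem_sp; case: eqP => [eK|_]; last by rewrite mul0r.
rewrite sp_idem; case: eqP => // lK; subst K; rewrite (fp_nf spP) //.
apply: (nf_ind (C := C)) => // [x n Cx|d u dd uu lu]; last by apply: Cv; rewrite ?lu.
elim: n => [|n IH]; first by rewrite mulr0n.
by rewrite mulrS -[x in C (x + _)]scale1r; apply: CL.
Qed.

Lemma finite_dimensional_span : finite_dimensional A.
Proof.
(* Each of the two parts of a valley has at most as many steps as a rank, hence at most [#|E|]. *)
pose I := (flat M * {bseq (#|E| + #|E|) of flat M})%type.
pose b (p : I) : A := sp p.1 p.2.
suff H x : exists c : I -> k, x = \sum_p c p *: b p.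
  exists #|{: I}|, (fun i => b (enum_val i)) => x; have [c ->] := H x.
  exists (fun i => c (enum_val i)).
  by rewrite -(big_enum_val (A := {: I}) (fun p => c p *: b p)).
elim/(fp_ind spP): x => [|a x y [c ->] [c' ->]|K s Ks].
- by exists (fun=> 0); rewrite big1 // => p _; rewrite scale0r.
- exists (fun p => a * c p + c' p); rewrite scaler_sumr -big_split.
  by apply: eq_bigr => p _; rewrite scalerDl scalerA.
rewrite (fp_nf spP) //.
apply: (nf_ind (C := fun x : A => exists c, x = \sum_p c p *: b p)) => // [|_ [c ->]|_ n [c ->]|d u dd uu _].
- by exists (fun=> 0); rewrite big1 // => p _; rewrite scale0r.
- by exists (fun p => - c p); rewrite -sumrN; apply: eq_bigr => p _; rewrite scaleNr.
- by exists (fun p => c p *+ n); rewrite -sumrMnl; apply: eq_bigr => p _; rewrite scalerMnl.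
have sz : (size (d ++ u) <= #|E| + #|E|)%N.
  rewrite size_cat leq_add //.
    apply: leq_trans (leq_trans (mrank_le_card M K) (max_card _)).
    by rewrite -(rank_down dd) leq_addl.
  apply: leq_trans (leq_trans (mrank_le_card M (last (last K d) u)) (max_card _)).
  by rewrite -(rank_up uu) leq_addl.
exists (fun p => (p == (K, Bseq sz))%:R); rewrite (bigD1 (K, Bseq sz)) //= eqxx scale1r.
by rewrite big1 ?addr0 // => p /negPf->; rewrite scale0r.
Qed.

(** No term of an (FS) sum is a one-flat path, so the indicator of the valley (F) is compatible. In
    particular [e F] is nonzero. *)
Lemma idem_coord F : exists2 Psi : A -> k^o, linear Psi & Psi (e F) = 1.
Proof.
pose ev K d u : k^o := [&& K == F, d == [::] & u == [::]]%:R.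
have evFS K : FS_compat K (ev K).
  split=> [[|? ?] Q P d u *|d [|? ?] Q P u *]; rewrite big1 // => X _;
  by rewrite /ev ?andbF.
have [Psi Psil PsiE] := fp_lift spP evFS; exists Psi => //.
by rewrite [LHS](PsiE F [::] [::]) // /ev !eqxx.
Qed.

Lemma one_dim_corner r i : (forall s, path r i s -> last i s = i -> s = [::]) ->
  one_dimensional (corner (e i) (span r) (e i)).
Proof.
move=> acyc; set U := corner _ _ _.
have eU c : c *: e i \in U by rewrite rpredZ // (@mem_corner r i [::]).
pose f (c : k^o) : subspace U := Subspace (eU c).
have fl : linear f.
  by move=> a b c; apply: val_inj; rewrite /= scalerDl -scalerA.
pose f' := HB.pack_for {linear k^o -> subspace U} f
  (GRing.isLinear.Build k k^o (subspace U) *:%R f fl).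
exists f'; have [Psi Psil Psi1] := idem_coord i.
have Psi0 : Psi 0 = 0.
  by have := Psil (-1) 0 0; rewrite scaler0 addr0 scaleN1r addNr.
have PsiZ c : Psi (c *: e i) = c.
  by rewrite -[_ *: _]addr0 Psil Psi0 Psi1 addr0; apply: mulr1.
exists (fun x => Psi (val x)) => [c|x]; first exact: PsiZ.
apply: val_inj; case: x => x xU /=.
move: x xU; apply: corner_ind => [|a x y Hx Hy|s /acyc si /si ->].
- by rewrite Psi0 scale0r.
- by rewrite Psil scalerDl Hy -[a *: Psi x]/(a * Psi x) -scalerA Hx.
- by rewrite Psi1 scale1r.
Qed.

Lemma nonzero_corner r i j : nonzero (corner (e j) (span r) (e i)) ->
  exists2 s, path r j s & last j s = i.
Proof.
move=> [x xC x0]; apply: contrapT => nos; case/eqP: x0.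
move: x xC; apply: corner_ind => // [a x y -> ->|s js ls].
  by rewrite scaler0 addr0.
by case: nos; exists s.
Qed.

End Reedy.

Lemma lin0 (R : pzRingType) (V W : lmodType R) (h : V -> W) : linear h -> h 0 = 0.
Proof. by move=> hl; have := hl (-1) 0 0; rewrite scaler0 addr0 scaleN1r addNr. Qed.

Lemma lin_sum (R : pzRingType) (V W : lmodType R) (h : V -> W) (I : Type) (r : seq I)
    (C : pred I) (x : I -> V) : linear h ->
  h (\sum_(i <- r | C i) x i) = \sum_(i <- r | C i) h (x i).
Proof.
move=> hl; elim/big_rec2: _ => [|i y z _ <-]; first exact: lin0.
by have := hl 1 (x i) z; rewrite !scale1r.
Qed.

(** * Injectivity and surjectivity of the multiplication map *)

Section Project.
Variables (k : fieldType) (A : lmodType k) (U : submodClosed A).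

(** The default 0 outside [U] makes this total but linear only on [U], which is why [bilinear_lift]
    asks for bilinearity on submodules only. *)
Definition to_subspace (x : A) : subspace U := insubd 0 x.

Lemma val_to_subspace x : x \in U -> val (to_subspace x) = x.
Proof. by move=> xU; rewrite /to_subspace insubdK. Qed.

Lemma to_subspaceK (x : subspace U) : to_subspace (val x) = x.
Proof. exact: valKd. Qed.

Lemma to_subspaceL a x y : x \in U -> y \in U ->
  to_subspace (a *: x + y) = a *: to_subspace x + to_subspace y.
Proof.
move=> xU yU; apply: val_inj; rewrite val_to_subspace ?rpredD ?rpredZ //.
by rewrite linearP /= !val_to_subspace.
Qed.
End Project.

Section TensorProject.
Variables (k : fieldType) (A : algType k) (U W : submodClosed A).

Definition tensor_project (x y : A) : tensor (subspace U) (subspace W) :=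
  tpure (to_subspace U x) (to_subspace W y).

Lemma tensor_projectPl y a x x' : x \in U -> x' \in U ->
  tensor_project (a *: x + x') y = a *: tensor_project x y + tensor_project x' y.
Proof. by move=> xU xU'; rewrite /tensor_project to_subspaceL // tpureDl tpureZl. Qed.

Lemma tensor_projectPr x a y y' : y \in W -> y' \in W ->
  tensor_project x (a *: y + y') = a *: tensor_project x y + tensor_project x y'.
Proof. by move=> yW yW'; rewrite /tensor_project to_subspaceL // tpureDr tpureZr. Qed.

Lemma mult_map0 : @mult_map k A U W 0 = 0.
Proof. exact: lin0 (@mult_map_linear _ _ _ _). Qed.

Lemma mult_mapD t t' : @mult_map k A U W (t + t') = mult_map t + mult_map t'.
Proof. by have := mult_map_linear 1 t t'; rewrite !scale1r. Qed.

Lemma comp_mult_map (T : lmodType k) (Psi : A -> T)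
    (h : tensor (subspace U) (subspace W) -> T) :
    linear Psi -> linear h ->
    (forall x y, x \in U -> y \in W -> Psi (x * y) = h (tensor_project x y)) ->
  forall t, Psi (mult_map t) = h t.
Proof.
move=> Psil hl e; elim/tensor_ind => [|v w t IH].
  by rewrite mult_map0 !lin0.
rewrite mult_mapD mult_mapE.
have := Psil 1 (val v * val w) (mult_map t); rewrite !scale1r => ->.
have := hl 1 (tpure v w) t; rewrite !scale1r => ->.
by rewrite IH (e _ _ (valP v) (valP w)) /tensor_project !to_subspaceK.
Qed.

Lemma corner_mult_map (f g : A) t : (forall x, x \in U -> f * x = x) ->
  (forall y, y \in W -> y * g = y) -> f * @mult_map k A U W t * g = mult_map t.
Proof.
move=> fU gW; elim/tensor_ind: t => [|v w t IH]; first by rewrite mult_map0 mulr0 mul0r.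
by rewrite mult_mapD mulrDr mulrDl IH mult_mapE mulrA (fU _ (valP v)) -mulrA (gW _ (valP w)).
Qed.

End TensorProject.

Section Triangular.
Variables (k : fieldType) (A : algType k) (I : finType) (e : I -> A).
Variables (Ap Am : subalgClosed A) (j i : I).

Local Notation D l := (corner (e j) Ap (e l)).
Local Notation U l := (corner (e l) Am (e i)).
Local Notation T := (forall l, tensor (subspace (D l)) (subspace (U l))).

(** With the l-th tensor product as target and [tensor_project] as bilinear map, the hypothesis
    yields a linear map that reads off the component [t l] from [triangular_map t]. *)
Lemma triangular_map_inj :
    (forall (V : lmodType k) l (B : A -> A -> V),
       (forall y, y \in U l -> forall a x x', x \in D l -> x' \in D l ->
          B (a *: x + x') y = a *: B x y + B x' y) ->
       (forall x, x \in D l -> forall a y y', y \in U l -> y' \in U l ->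
          B x (a *: y + y') = a *: B x y + B x y') ->
       exists2 Psi : A -> V, linear Psi & forall l' x y, x \in D l' -> y \in U l' ->
         Psi (x * y) = if l' == l then B x y else 0) ->
  forall t t' : T, triangular_map t = triangular_map t' -> forall l, t l = t' l.
Proof.
move=> H t t' tt' l.
have [y _ a x x'|x _ a y y'|Psi Psil PsiE] := H _ l (tensor_project (D l) (U l)).
- exact: tensor_projectPl.
- exact: tensor_projectPr.
suff PsiT (t0 : T) : Psi (triangular_map t0) = t0 l by rewrite -PsiT tt' PsiT.
rewrite /triangular_map lin_sum // (bigD1 l) //= big1 => [|l' nl].
  rewrite addr0; apply: (comp_mult_map (h := id)) => // x y xD yU.
  by rewrite (PsiE _ _ _ xD yU) eqxx.
apply: (comp_mult_map (h := fun=> 0)) => // [a x y|x y xD yU].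
  by rewrite scaler0 addr0.
by rewrite (PsiE _ _ _ xD yU) (negPf nl).
Qed.

Lemma triangular_map_surj :
    (forall C : A -> Prop, C 0 -> (forall a x y, C x -> C y -> C (a *: x + y)) ->
       (forall l x y, x \in D l -> y \in U l -> C (x * y)) ->
       forall x, x \in corner (e j) predT (e i) -> C x) ->
    (forall l x, x \in D l -> e j * x = x) -> (forall l y, y \in U l -> y * e i = y) ->
  forall x, x \in corner (e j) predT (e i) <-> exists t : T, x = triangular_map t.
Proof.
move=> H eD eU x; split=> [|[t ->]]; last first.
  apply/asboolP; exists (triangular_map t) => //.
  rewrite /triangular_map mulr_sumr mulr_suml; apply: eq_bigr => l _.
  by rewrite corner_mult_map // => y; [apply: eD | apply: eU].
move: x; apply: H => [|a _ _ [t ->] [t' ->]|l x y xD yU].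
- by exists (fun l => 0); rewrite /triangular_map big1 // => l _; apply: mult_map0.
- exists (fun l => a *: t l + t' l); rewrite /triangular_map scaler_sumr -big_split.
  by apply: eq_bigr => l _; rewrite mult_map_linear.
exists (fun l' => if l' == l then tensor_project (D l') (U l') x y else 0).
rewrite /triangular_map (bigD1 l) //= eqxx big1 => [|l' /negPf ->]; last exact: mult_map0.
by rewrite mult_mapE !val_to_subspace ?addr0.
Qed.

End Triangular.

Section Reedy.
Variables (E : finType) (M : matroid E) (k : fieldType) (A : algType k).
Variables (sp : flat M -> seq (flat M) -> A) (spP : flag_presentation sp).
Implicit Types (F G K L P Q X Y : flat M) (d u s : seq (flat M)) (r : rel (flat M)).
Local Notation e := (fun F => sp F [::]).
Local Notation span := (path_subalg spP).
Local Notation Ap := (span (@down E M)).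
Local Notation Am := (span (@up E M)).

Lemma corner_idl r i j x : x \in corner (e j) (span r) (e i) -> e j * x = x.
Proof.
move: x; apply: corner_ind => [|a y z Hy Hz|s js ls]; first by rewrite mulr0.
  by rewrite mulrDr -scalerAr Hy Hz.
by rewrite (idem_sp spP) eqxx.
Qed.

Lemma corner_idr r i j x : x \in corner (e j) (span r) (e i) -> x * e i = x.
Proof.
move: x; apply: corner_ind => [|a y z Hy Hz|s js ls]; first by rewrite mul0r.
  by rewrite mulrDl -scalerAl Hy Hz.
by rewrite (sp_idem spP) ls eqxx.
Qed.

Lemma schur_triangular : triangular_decomposition e Ap Am.
Proof.
move=> j i; split.
  apply: triangular_map_inj => V l B Bl Br.
  have [||Psi Psil PsiE] := bilinear_lift spP (l := l) (cK := pred1 j) (cI := pred1 i)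
    (D := corner (e j) Ap (e l)) (U := corner (e l) Am (e i)) _ _ Bl Br.
  - by move=> K d /eqP -> dd <-; apply: mem_corner.
  - by move=> u /eqP <- uu; apply: mem_corner.
  exists Psi; first exact: Psil.
  by move=> l' x y xD yU; rewrite (PsiE _ _ _ _ _ xD yU) /= !eqxx andbT.
apply: triangular_map_surj => [C C0 CL Cm|l x|l y]; last 2 first.
- exact: corner_idl.
- exact: corner_idr.
apply: corner_valley_ind => // d u dd uu lu.
by rewrite (sp_catE spP); apply: (Cm (last j d)); rewrite -?lu; apply: mem_corner.
Qed.

Lemma down_loop i s : path (@down E M) i s -> last i s = i -> s = [::].
Proof.
move=> /rank_down + li; rewrite li => /eqP.
by rewrite -[X in _ == X]addn0 eqn_add2l => /nilP.
Qed.

Lemma up_loop i s : path (@up E M) i s -> last i s = i -> s = [::].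
Proof.
move=> /rank_up + li; rewrite li => /eqP.
by rewrite -[X in _ == X]addn0 eqn_add2l => /nilP.
Qed.

Lemma schur_reedy : reedy_algebra e.
Proof.
split; [exact: finite_dimensional_span spP|exact: flat_idem_complete spP|].
exists (fun F => M F), Ap, Am; split.
- split=> [i|i j ij /nonzero_corner[s js ls]].
    by apply: one_dim_corner; apply: down_loop.
  rewrite -(rank_down js) ls -addn1 leq_add2l lt0n size_eq0.
  by apply: contra ij => /eqP s0; rewrite -ls s0.
- split=> [i|i j ij /nonzero_corner[s js ls]].
    by apply: one_dim_corner; apply: up_loop.
  have := rank_up js; rewrite ls => <-; rewrite -addn1 leq_add2l lt0n size_eq0.
  by apply: contra ij => /eqP s0; rewrite -ls s0.
- exact: schur_triangular.
Qed.
End Reedy.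

(** * Heredity chain *)

Section IdealInd.
Variables (R : pzRingType) (G : R -> Prop).

Lemma gen_ideal_ind (C : R -> Prop) :
    C 0 -> (forall x y, C x -> C y -> C (x - y)) ->
    (forall a x, C x -> C (a * x)) -> (forall a x, C x -> C (x * a)) ->
    (forall x, G x -> C x) -> forall x, x \in gen_ideal G -> C x.
Proof.
move=> C0 CB CMl CMr CG x xG.
pose S : {pred R} := fun x => `[< C x >].
have Sz : zmod_closed S.
  by split=> [|y z /asboolP Cy /asboolP Cz]; apply/asboolP => //; apply: CB.
have St : two_sided S.
  by move=> a y /asboolP Cy; split; apply/asboolP; [apply: CMl | apply: CMr].
pose S' := HB.pack_for (tideal R) (S : R -> bool)
  (GRing.isZmodClosed.Build R S Sz) (isTwoSided.Build R S St).
suff : x \in S' by move/asboolP.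
by apply: gen_ideal_min xG => y /CG Cy; apply/asboolP.
Qed.

End IdealInd.

(** * Dual bases and projectivity *)

Section DualBasis.

(** The dual basis criterion: preimages of the [h (u i)] are chosen, and the coordinates [theta i]
    assemble them into a lift of [h]. *)
Lemma dual_basis_projective (R : pzRingType) (U : submodClosed R^o) (I : finType)
    (C : pred I) (u : I -> R) (theta : I -> R -> R) :
    (forall i, C i -> (u i : R^o) \in U) ->
    (forall i, C i -> forall a x y, (x : R^o) \in U -> (y : R^o) \in U ->
       theta i (a * x + y) = a * theta i x + theta i y) ->
    (forall x, (x : R^o) \in U -> \sum_(i | C i) theta i x * u i = x) ->
  projective (subspace U).
Proof.
move=> uU thL thE V W g h g_surj.
pose w i : subspace U := insubd 0 (u i : R^o).
have wE i : C i -> val (w i) = u i.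
  by move=> /uU ui; rewrite /w insubdK.
have [m mE] := choice (fun i => g_surj (h (w i))).
pose f (x : subspace U) : V := \sum_(i | C i) theta i (val x : R) *: m i.
have fl : linear f.
  move=> a x y; rewrite /f scaler_sumr -big_split; apply: eq_bigr => i Ci /=.
  rewrite scalerA -scalerDl -(thL i Ci _ _ _ (valP x) (valP y)).
  by congr (theta i _ *: _).
pose f' := HB.pack_for {linear subspace U -> V} f (GRing.isLinear.Build R _ _ *:%R f fl).
exists f' => x; have xE : x = \sum_(i | C i) theta i (val x : R) *: w i.
  apply: val_inj; rewrite raddf_sum /= -[LHS](thE _ (valP x)).
  by apply: eq_bigr => i Ci; rewrite -(wE i Ci).
rewrite [X in g X](_ : _ = \sum_(i | C i) theta i (val x : R) *: m i) // linear_sum.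
rewrite [in RHS]xE linear_sum.
by apply: eq_bigr => i _; rewrite !linearZ_LR /= mE.
Qed.

(** A spanning subfamily of least cardinality is independent in the sense needed: a nonzero
    coefficient in a relation could be inverted to remove a member. Its coordinates are therefore
    linear on [U]; members outside it get coordinate 0. *)
Lemma dual_family (k : fieldType) (V : lmodType k) (U : submodClosed V) (I : finType)
    (u : I -> V) :
    (forall x, x \in U -> exists c : I -> k, x = \sum_i c i *: u i) ->
  exists sigma : I -> V -> k,
    (forall i a x y, x \in U -> y \in U -> sigma i (a *: x + y) = a * sigma i x + sigma i y) /\
    (forall x, x \in U -> \sum_i sigma i x *: u i = x).
Proof.
move=> spanU.
pose spans (S : {set I}) := `[< forall x, x \in U ->
  exists c : I -> k, x = \sum_(i in S) c i *: u i >].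
have spT : spans setT.
  apply/asboolP => x /spanU[c ->]; exists c.
  by apply: eq_bigl => i; rewrite inE.
case: (arg_minnP (fun S : {set I} => #|S|) spT) => S /asboolP spS minS.
have free (c : I -> k) : \sum_(i in S) c i *: u i = 0 -> forall i, i \in S -> c i = 0.
  move=> c0 i iS; apply/eqP/negPn/negP => ci0.
  have ui : u i = \sum_(j in S :\ i) (- (c i)^-1 * c j) *: u j.
    move: c0; rewrite (big_setD1 i) //= => /eqP; rewrite addr_eq0 => /eqP e.
    rewrite -[LHS]scale1r -(mulVf ci0) -scalerA e scalerN scaler_sumr -sumrN.
    by apply: eq_bigr => j _; rewrite scalerA mulNr scaleNr.
  have /minS : spans (S :\ i).
    apply/asboolP => x /spS[c' ->]; exists (fun j => c' j + c' i * (- (c i)^-1 * c j)).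
    rewrite (big_setD1 i) //= ui scaler_sumr -big_split /=.
    by apply: eq_bigr => j _; rewrite scalerA -scalerDl addrC.
  by rewrite (cardsD1 i S) iS add1n ltnn.
have [sg sgE] : exists sg : V -> I -> k, forall x, x \in U ->
    x = \sum_(i in S) sg x i *: u i.
  have H x : exists c : I -> k, x \in U -> x = \sum_(i in S) c i *: u i.
    have [xU|] := boolP (x \in U); last by exists (fun=> 0).
    by have [c ->] := spS x xU; exists c.
  by have [sg sgE] := choice H; exists sg.
exists (fun i x => if i \in S then sg x i else 0); split=> [i a x y xU yU|x xU]; last first.
  rewrite [RHS](sgE x xU) [RHS]big_mkcond /=; apply: eq_bigr => i _.
  by case: ifP => // _; rewrite scale0r.
case: ifPn => iS; last by rewrite mulr0 addr0.
apply/eqP; rewrite -subr_eq0; apply/eqP; move: i iS; apply: free.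
have axyU : a *: x + y \in U by rewrite rpredD // rpredZ.
under eq_bigr do rewrite scalerBl scalerDl -scalerA.
by rewrite sumrB big_split -scaler_sumr /= -!sgE // subrr.
Qed.

End DualBasis.

Section QuasiHereditary.
Variables (E : finType) (M : matroid E) (k : fieldType) (A : algType k).
Variables (sp : flat M -> seq (flat M) -> A) (spP : flag_presentation sp).
Implicit Types (F G K L P Q X Y : flat M) (d u s : seq (flat M)) (r : rel (flat M)).
Local Notation e := (fun F => sp F [::]).
Let spM := fp_mul spP.

Lemma sp_up_step K L d u : covers K L -> path (@down E M) L d ->
  path (@up E M) (last L d) u ->
  sp K [:: L] * sp L (d ++ u) = push K L d u (fun d u => sp K (d ++ u)).
Proof.
move=> KL dd uu; rewrite -(sp_catE spP K [:: L]) (fp_nf spP) /=.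
  by rewrite nf_valley // (covers_asym KL).
by rewrite adj_up //= adjacent_valley.
Qed.

Definition low_ideal n : {pred A} :=
  gen_ideal (fun x : A => exists2 F : flat M, (M F < n)%N & x = sp F [::]).
HB.instance Definition _ n := GRing.ZmodClosed.on (low_ideal n).
HB.instance Definition _ n := TIdeal.on (low_ideal n).

(** The explicit form of [low_ideal n]: it contains the ideal by [low_idealP], and [path_low] gives
    the converse on generators. *)
Definition low_span n : {pred A} := gen_submod (fun x : A => exists K d u,
  [/\ path (@down E M) K d, path (@up E M) (last K d) u, (M (last K d) < n)%N &
      x = sp K (d ++ u)]).
HB.instance Definition _ n := GRing.SubmodClosed.on (low_span n).

Lemma valley_low_span n K d u : path (@down E M) K d -> path (@up E M) (last K d) u ->
  (M (last K d) < n)%N -> sp K (d ++ u) \in low_span n.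
Proof. by move=> *; apply: mem_gen_submod; exists K, d, u. Qed.

(** A down step on the left lengthens the valley, and an up step is pushed through without raising
    the bottom. *)
Lemma low_span_Ml n a x : x \in low_span n -> a * x \in low_span n.
Proof.
elim/(fp_ind spP): a x => [|c a b IHa IHb|K s Ks] x.
- by rewrite mul0r rpred0.
- by move=> xn; rewrite mulrDl -scalerAl rpredD ?rpredZ ?IHa ?IHb.
elim: s K Ks x => [|L s IH] K.
  move=> _; apply: gen_submod_ind => [|c x y Hx Hy|_ [K' [d [u [dd uu lt ->]]]]].
  - by rewrite mulr0 rpred0.
  - by rewrite mulrDr -scalerAr rpredD ?rpredZ.
  by rewrite (idem_sp spP); case: ifP; rewrite ?rpred0 ?valley_low_span.
move=> /andP[aKL Ls] x xn; rewrite (sp_catE spP K [:: L]) -mulrA /=.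
move: (IH L Ls x xn) => {IH xn}; move: (_ * x) => {}x.
move: x; apply: gen_submod_ind => [|c x y Hx Hy|_ [K' [d [u [dd uu lt ->]]]]].
- by rewrite mulr0 rpred0.
- by rewrite mulrDr -scalerAr rpredD ?rpredZ.
have [eL|neL] := eqVneq L K'; last by rewrite spM /= (negPf neL) rpred0.
subst K'; case cLK: (covers L K).
  rewrite -(sp_catE spP K [:: L]); apply: (@valley_low_span n K (L :: d)) => //.
  by rewrite /= [down _ _]cLK.
have cKL : covers K L by move: aKL; rewrite /adjacent cLK orbF.
rewrite sp_up_step //; apply: (push_ind (C := fun x => x \in low_span n)) => //.
- exact: rpred0.
- by move=> y; rewrite -scaleN1r; apply: rpredZ.
- by move=> y m yn; rewrite -scaler_nat rpredZ.
move=> d' u' dd' uu' _ le; apply: valley_low_span => //; exact: leq_ltn_trans le lt.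
Qed.

(** Only the ascending part followed by the new path is reduced: the resulting valley starts at the
    old bottom, so its own bottom is no higher, and prefixing [d] gives a valley again. *)
Lemma low_span_Mr n a x : x \in low_span n -> x * a \in low_span n.
Proof.
move: x; apply: gen_submod_ind => [|c x y Hx Hy|_ [K [d [u [dd uu lt ->]]]]].
- by rewrite mul0r rpred0.
- by rewrite mulrDl -scalerAl rpredD ?rpredZ.
elim/(fp_ind spP): a => [|c a b IHa IHb|K' s Ks].
- by rewrite mulr0 rpred0.
- by rewrite mulrDr -scalerAr rpredD ?rpredZ.
rewrite spM; case: eqP => [eK|_]; last by rewrite rpred0.
rewrite -catA (sp_catE spP) [sp (last K d) _](fp_nf spP); last first.
  rewrite cat_path (sub_path _ uu) => [|X Y /adj_up] //.
  by move: eK; rewrite last_cat => ->.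
apply: (nf_ind (C := fun x => sp K d * x \in low_span n)).
- by rewrite mulr0 rpred0.
- by move=> y; rewrite mulrN -scaleN1r; apply: rpredZ.
- by move=> y m yn; rewrite mulrnAr -scaler_nat rpredZ.
- rewrite cat_path (sub_path _ uu) => [|X Y /adj_up] //.
  by move: eK; rewrite last_cat => ->.
move=> d' u' dd' uu' _; rewrite -(sp_catE spP) catA; apply: valley_low_span.
- by rewrite cat_path dd.
- by rewrite last_cat.
rewrite last_cat; apply: leq_ltn_trans lt.
by rewrite -(rank_down dd') leq_addr.
Qed.

Lemma low_idealP n x : x \in low_ideal n -> x \in low_span n.
Proof.
move: x; apply: (gen_ideal_ind (C := fun x => x \in low_span n)) =>
  [|y z Hy Hz|a y|a y|_ [F ltF ->]].
- exact: rpred0.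
- by rewrite -scaleN1r rpredD ?rpredZ.
- exact: low_span_Ml.
- exact: low_span_Mr.
exact: (@valley_low_span n F [::] [::]).
Qed.

Lemma idem_low n F : (M F < n)%N -> sp F [::] \in low_ideal n.
Proof. by move=> ltF; apply: mem_gen_ideal; exists F. Qed.

Lemma path_low n K d u : (M (last K d) < n)%N -> sp K (d ++ u) \in low_ideal n.
Proof.
move=> lt; rewrite (sp_catE spP) -[sp K d](_ : sp K d * sp (last K d) [::] = _).
  by rewrite tidealMr // tidealMl // idem_low.
by rewrite (sp_idem spP) eqxx.
Qed.

Lemma low_idealZ n c x : x \in low_ideal n -> c *: x \in low_ideal n.
Proof. by move=> xn; rewrite -[x]mul1r scalerAl tidealMl. Qed.

(** A valley that descends at all from [F] has bottom of rank below [M F]. One that does not descend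
    is an ascending path between flats of equal rank, hence trivial. *)
Lemma corner_low F G x : M F = M G ->
  exists c : k, sp F [::] * x * sp G [::] - (if F == G then c *: sp F [::] else 0)
    \in low_ideal (M F).
Proof.
move=> FG; pose C (x : A) := exists c : k,
  x - (if F == G then c *: sp F [::] else 0) \in low_ideal (M F).
suff : C (sp F [::] * x * sp G [::]) by [].
apply: (corner_valley_ind spP (j := F) (i := G)); last by apply/asboolP; exists x.
- by exists 0; rewrite scale0r if_same subr0 rpred0.
- move=> a y z [c yc] [c' zc]; exists (a * c + c').
  have -> : a *: y + z - (if F == G then (a * c + c') *: sp F [::] else 0) =
     a *: (y - (if F == G then c *: sp F [::] else 0)) +
     (z - (if F == G then c' *: sp F [::] else 0)).
    rewrite scalerBr addrACA -opprD; congr (_ - _).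
    by case: ifP; rewrite ?scaler0 ?addr0 // scalerDl scalerA.
  by apply: rpredD => //; apply: low_idealZ.
move=> d u dd uu lu; have [d0|d0] := posnP (size d); last first.
  exists 0; rewrite scale0r if_same subr0; apply: path_low.
  by rewrite -(rank_down dd) -addn1 leq_add2l.
move/size0nil: d0 uu lu dd => -> /= uu lu _.
have u0 : u = [::].
  apply/nilP; have /eqP := rank_up uu.
  by rewrite lu -FG -[X in _ == X]addn0 eqn_add2l.
exists 1; move: lu; rewrite u0 /= => ->.
by rewrite eqxx scale1r subrr rpred0.
Qed.

End QuasiHereditary.

(* Since the nonzero elements of [f R f] are invertible in it, the left ideal
   [{x | f R x a f = 0}] is maximal or contains 1; in both cases it contains [r]. *)
Lemma radical_corner (R : pzRingType) (f a b r : R) :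
    (forall x, f * x * f = 0 \/ exists2 c, c * f = c & c * (f * x * f) = f) ->
  jacobson_radical r -> f * b * r * a * f = 0.
Proof.
move=> fR rad_r.
pose S : {pred R^o} := fun x => `[< forall y : R, f * y * (x : R) * a * f = 0 >].
have Sc : submod_closed S.
  split; first by apply/asboolP => y; rewrite mulr0 !mul0r.
  move=> c x y /asboolP xS /asboolP yS; apply/asboolP => z.
  have -> : f * z * (c * (x : R) + (y : R)) * a * f =
            f * (z * c) * (x : R) * a * f + f * z * (y : R) * a * f.
    by rewrite mulrDr !mulrDl !mulrA.
  by rewrite xS yS addr0.
pose I := HB.pack_for (submodClosed R^o) (S : R^o -> bool)
  (GRing.isSubmodClosed.Build R R^o S Sc).
have [/asboolP I1|nI1] := boolP ((1 : R^o) \in I).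
  by have := I1 (b * r); rewrite mulr1 mulrA.
have /asboolP -> // : (r : R^o) \in I.
apply: rad_r; split=> // J IJ J1 x xJ; apply/asboolP => y.
have [//|[c cf fyE]] := fR (y * (x : R) * a).
  by rewrite !mulrA.
case/negP: J1.
have zJ : (a * c * f * y * (x : R) : R^o) \in J by apply: (rpredZ (a * c * f * y)).
rewrite -[1 : R^o](subrK (a * c * f * y * (x : R) : R^o)); apply: rpredD => //.
apply: IJ; apply/asboolP => z.
have -> : f * z * (1 - a * c * f * y * (x : R)) * a * f =
   f * z * a * f - f * z * a * (c * (f * (y * (x : R) * a) * f)).
  by rewrite mulrBr mulr1 !mulrBl !mulrA.
by rewrite fyE subrr.
Qed.

(** * The layers $J_{n+1}/J_n$ *)

Section Chain.
Variables (E : finType) (M : matroid E) (k : fieldType) (A : algType k).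
Variables (sp : flat M -> seq (flat M) -> A) (spP : flag_presentation sp).
Implicit Types (F G K L P Q X Y l : flat M) (d u : seq (flat M)).
Let spM := fp_mul spP.
Local Notation J := (low_ideal sp).

Lemma low_ideal_sub n : {subset J n <= J n.+1}.
Proof.
apply: gen_ideal_min => _ [F ltF ->]; apply: mem_gen_ideal; exists F => //.
exact: ltnW.
Qed.

Lemma low_ideal0 : J 0%N =i pred1 0.
Proof.
move=> x; apply/idP/eqP => [|->]; last exact: rpred0.
move: x; apply: (gen_ideal_ind (C := fun x => x = 0)) => // [x y -> ->|a x ->|a x ->|x [F]//].
- exact: subrr.
- exact: mulr0.
- exact: mul0r.
Qed.

Lemma low_ideal_full : J (M setT).+1 =i predT.
Proof.
move=> x; rewrite [RHS]inE; rewrite -[x]mulr1 -(fp_one spP) tidealMl //.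
by rewrite rpred_sum // => F _; apply: idem_low; rewrite ltnS mrank_mono ?subsetT.
Qed.

Section Layer.
Variable n : nat.
Local Notation R := (rquot (J n)).
Local Notation pi := (@rpi A (J n)).
Local Notation JR := (ideal_image (J := J n) (J n.+1)).

Lemma pi_eq0 x : x \in J n -> pi x = 0.
Proof. by move=> xn; rewrite -(raddf0 pi); apply/rpi_eqE; rewrite subr0. Qed.

Lemma corner_pi F G (z : R) : (M F < n.+1)%N -> (M G < n.+1)%N ->
  exists c : k, pi (sp F [::]) * z * pi (sp G [::]) =
    if F == G then pi (c *: sp F [::]) else 0.
Proof.
have low K : (M K < n.+1)%N -> (M K = n) \/ pi (sp K [::]) = 0.
  rewrite ltnS leq_eqVlt => /orP[/eqP|lt]; first by left.
  by right; apply/pi_eq0/idem_low.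
have zero : exists c : k, 0 = if F == G then pi (c *: sp F [::]) else 0.
  by exists 0; rewrite scale0r raddf0 if_same.
move=> /low[rF|->] /low[rG|->]; rewrite ?mulr0 ?mul0r //.
have [x ->] := rpi_surj z; have [|c] := corner_low spP (F := F) (G := G) x.
  by rewrite rF rG.
rewrite rF => /rpi_eqE H; exists c.
have -> : pi (sp F [::]) * pi x * pi (sp G [::]) = pi (sp F [::] * x * sp G [::]).
  by rewrite !rmorphM.
by rewrite [LHS]H; case: ifP => // _; apply: raddf0.
Qed.

Lemma low_radical x r y : x \in JR -> jacobson_radical r -> y \in JR -> x * r * y = 0.
Proof.
move=> /asboolP[x0 x0n ->] rad_r /asboolP[y0 y0n ->].
(* For generators, distinct flats give a zero corner, and equal flats a corner of multiples of one
   idempotent, where [radical_corner] applies. The free factors [a] and [b] absorb the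
   multiplications met when passing from generators to the ideals. *)
have gens F G a b : (M F < n.+1)%N -> (M G < n.+1)%N ->
    pi (sp F [::]) * b * r * a * pi (sp G [::]) = 0.
  move=> ltF ltG; have [eFG|neFG] := eqVneq F G; last first.
    by have [c] := corner_pi (b * r * a) ltF ltG; rewrite (negPf neFG) !mulrA.
  subst G; apply: radical_corner => // z; have [c ->] := corner_pi z ltF ltF.
  rewrite eqxx; have [->|c0] := eqVneq c 0; first by left; rewrite scale0r raddf0.
  right; exists (pi (c^-1 *: sp F [::])); rewrite -rmorphM -scalerAl.
    by rewrite (idem_sp spP) eqxx.
  by rewrite -scalerAr (idem_sp spP) eqxx scalerA mulVf // scale1r.
have left_gen G a b : (M G < n.+1)%N -> pi x0 * b * r * a * pi (sp G [::]) = 0.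
  move=> ltG; move: x0 x0n b.
  apply: gen_ideal_ind => [|v w Hv Hw|c v Hv|c v Hv|_ [F ltF ->]] b.
  - by rewrite raddf0 !mul0r.
  - by rewrite raddfB !mulrBl Hv Hw subrr.
  - by rewrite rmorphM -!mulrA; have := Hv b; rewrite -!mulrA => ->; rewrite mulr0.
  - by rewrite rmorphM -(mulrA (pi v)) Hv.
  - exact: gens.
have : forall a, pi x0 * r * a * pi y0 = 0; last by move/(_ 1); rewrite mulr1.
move: y0 y0n; apply: gen_ideal_ind => [|v w Hv Hw|c v Hv|c v Hv|_ [F ltF ->]] a.
- by rewrite raddf0 mulr0.
- by rewrite raddfB mulrBr Hv Hw subrr.
- by rewrite rmorphM mulrA -(mulrA _ a) Hv.
- by rewrite rmorphM mulrA Hv mul0r.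
- by have := left_gen F a 1 ltF; rewrite mulr1.
Qed.

(** The generators are idempotent, so each is a product of two elements of the ideal; multiplication
    by a ring element is absorbed in an outer factor. *)
Lemma low_idempotent x : x \in J n.+1 -> exists m (y z : 'I_m -> A),
  (forall i, y i \in J n.+1 /\ z i \in J n.+1) /\ x = \sum_i y i * z i.
Proof.
move=> xn; suff [s [sn ->]] : exists s : seq (A * A),
    (forall p, p \in s -> p.1 \in J n.+1 /\ p.2 \in J n.+1) /\ x = \sum_(p <- s) p.1 * p.2.
  exists (size s), (fun i => (nth (0, 0) s i).1), (fun i => (nth (0, 0) s i).2).
  split=> [i|]; first by apply: sn; rewrite mem_nth.
  by rewrite (big_nth (0, 0)) big_mkord.
move: x xn; apply: gen_ideal_ind =>
  [|x y [s [sn ->]] [t [tn ->]]|a x [s [sn ->]]|a x [s [sn ->]]|_ [F ltF ->]].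
- by exists [::]; rewrite big_nil.
- exists (s ++ [seq (- p.1, p.2) | p <- t]); split=> [p|].
    rewrite mem_cat => /orP[/sn //|/mapP[q /tn[q1 q2] ->]].
    by rewrite rpredN.
  rewrite big_cat big_map /= -sumrN; congr (_ + _).
  by apply: eq_bigr => p _; rewrite mulNr.
- exists [seq (a * p.1, p.2) | p <- s]; split=> [p /mapP[q /sn[q1 q2] ->]|].
    by rewrite tidealMl.
  by rewrite big_map mulr_sumr; apply: eq_bigr => p _; rewrite mulrA.
- exists [seq (p.1, p.2 * a) | p <- s]; split=> [p /mapP[q /sn[q1 q2] ->]|].
    by rewrite tidealMr.
  by rewrite big_map mulr_suml; apply: eq_bigr => p _; rewrite mulrA.
exists [:: (sp F [::], sp F [::])]; split=> [p|].
  by rewrite inE => /eqP ->; split; apply: idem_low.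
by rewrite big_seq1 (idem_sp spP) eqxx.
Qed.

Lemma layer_ind (C : R -> Prop) :
    C 0 -> (forall x y, C x -> C y -> C (x + y)) ->
    (forall l (a : A) u, M l = n -> path (@up E M) l u -> a * sp l [::] = a ->
       C (pi (a * sp l u))) ->
  forall x, x \in JR -> C x.
Proof.
move=> C0 CD Cg _ /asboolP[x /(low_idealP spP) xn ->].
(* [C] is only closed under sums, so the scalar is carried along and finally absorbed in the left
   factor. *)
suff H : forall c : k, C (pi (c *: x)) by have := H 1; rewrite scale1r.
move: x xn; apply: gen_submod_ind => [c|a x y Hx Hy c|_ [K [d [u [dd uu lt ->]]]] c].
- by rewrite scaler0 raddf0.
- by rewrite scalerDr scalerA raddfD; apply: CD; [apply: Hx | apply: Hy].
move: lt; rewrite ltnS leq_eqVlt => /orP[/eqP eM|lt]; last first.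
  by rewrite pi_eq0 //; apply: low_idealZ; apply: (path_low spP).
rewrite (sp_catE spP) scalerAl; apply: Cg => //.
by rewrite -scalerAl (sp_idem spP) eqxx.
Qed.

Definition up_from l : {pred A} :=
  gen_submod (fun x : A => exists2 u, path (@up E M) l u & x = sp l u).
HB.instance Definition _ l := GRing.SubmodClosed.on (up_from l).

Local Notation I := ({bseq #|E| of flat M}).

Definition up_gen l (s : I) : A := if path (@up E M) l s then sp l s else 0.

Lemma up_genM F l s : sp F [::] * up_gen l s = if F == l then up_gen l s else 0.
Proof.
rewrite /up_gen; case: ifP => _; last by rewrite mulr0 if_same.
by rewrite (idem_sp spP).
Qed.

Lemma up_from_span l x : x \in up_from l -> exists c : I -> k, x = \sum_i c i *: up_gen l i.
Proof.
move: x; apply: gen_submod_ind => [|a x y [c ->] [c' ->]|_ [u lu ->]].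
- by exists (fun=> 0); rewrite big1 // => p _; rewrite scale0r.
- exists (fun p => a * c p + c' p); rewrite scaler_sumr -big_split.
  by apply: eq_bigr => p _; rewrite scalerDl scalerA.
have sz : (size u <= #|E|)%N.
  apply: leq_trans (leq_trans (mrank_le_card M (last l u)) (max_card _)).
  by rewrite -(rank_up lu) leq_addl.
exists (fun p => (p == Bseq sz)%:R); rewrite (bigD1 (Bseq sz)) //= eqxx scale1r.
by rewrite big1 ?addr0 /up_gen /= ?lu // => p /negPf->; rewrite scale0r.
Qed.

(* [theta l s] extends [x * y |-> sigma s y *: x], for [x] a down path into [l]
   and [y] an up path out of [l]; modulo [J n] it is left linear on [J n.+1]. *)
Lemma theta_exists l (sigma : I -> A -> k) : M l = n ->
    (forall s a x y, x \in up_from l -> y \in up_from l ->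
       sigma s (a *: x + y) = a * sigma s x + sigma s y) ->
  exists theta : I -> A -> A, forall s,
  [/\ linear (theta s), forall x, x \in J n -> theta s x = 0 &
      forall (l' : flat M) x u, M l' = n -> path (@up E M) l' u -> x * sp l' [::] = x ->
        theta s (x * sp l' u) - (if l' == l then sigma s (sp l u) *: x else 0) \in J n].
Proof.
move=> rl sL.
suff /choice[theta H] : forall s, exists theta : A -> A,
    [/\ linear theta, forall x, x \in J n -> theta x = 0 &
      forall (l' : flat M) x u, M l' = n -> path (@up E M) l' u -> x * sp l' [::] = x ->
        theta (x * sp l' u) - (if l' == l then sigma s (sp l u) *: x else 0) \in J n].
  by exists theta.
move=> s.
(* The submodule generated by the true predicate is all of [A]: here the bilinear map is linear in
   [x] everywhere, and no end point is prescribed. *)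
have [||y _ a x x' _ _|x _ a y y' yU yU'|theta thl thE] :=
  bilinear_lift spP (T := A) (l := l) (cK := predT) (cI := predT)
    (D := gen_submod (fun x : A => True)) (U := up_from l) (B := fun x y => sigma s y *: x).
- by move=> *; apply: mem_gen_submod.
- by move=> u _ lu; apply: mem_gen_submod; exists u.
- by rewrite scalerDr !scalerA mulrC.
- by rewrite sL // scalerDl scalerA.
have thV K d u : path (@down E M) K d -> path (@up E M) (last K d) u ->
    theta (sp K d * sp (last K d) u) =
    if last K d == l then sigma s (sp l u) *: sp K d else 0.
  move=> dd uu; rewrite (thE K (last K d) (last (last K d) u)) ?mem_corner //=.
  by rewrite andbT; case: eqP => // ->.
have th0 x : x \in J n -> theta x = 0.
  move/(low_idealP spP); move: x; apply: gen_submod_ind =>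
    [|a x y Hx Hy|_ [K [d [u [dd uu lt ->]]]]].
  - exact: lin0.
  - by rewrite thl Hx Hy scaler0 addr0.
  rewrite (sp_catE spP) thV //; case: eqP => // el.
  by move: lt; rewrite el rl ltnn.
exists theta; split=> // l' x u rl' lu xl'.
pose q (z : A) := theta (z * sp l' u) - (if l' == l then sigma s (sp l u) *: z else 0).
have q0 : q 0 = 0 by rewrite /q mul0r (lin0 thl) scaler0 if_same subr0.
have qL a y z : q (a *: y + z) = a *: q y + q z.
  rewrite /q mulrDl -scalerAl thl scalerBr addrACA -opprD; congr (_ - _).
  case: ifP => _; last by rewrite scaler0 addr0.
  by rewrite scalerDr !scalerA [_ * a]mulrC.
have qJ a y z : q y \in J n -> q z \in J n -> q (a *: y + z) \in J n.
  by move=> yn zn; rewrite qL rpredD // low_idealZ.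
(* Writing [x] as [x * sp l' [::]] frees [x], so that it can be decomposed into arbitrary paths. *)
rewrite -[_ - _]/(q x) -xl'; move: {xl'}x.
apply: (fp_ind spP) => [|a x y Hx Hy|K t Kt]; first by rewrite mul0r q0 rpred0.
  by rewrite mulrDl -scalerAl qJ.
rewrite (sp_idem spP); case: eqP => [lt|_]; last by rewrite q0 rpred0.
rewrite (fp_nf spP) //.
apply: (nf_ind (C := fun z => q z \in J n)) => //.
- by rewrite q0 rpred0.
- by move=> z zn; rewrite -[- z]addr0 -scaleN1r qJ // q0 rpred0.
- move=> z m zn; elim: m => [|m IH]; first by rewrite mulr0n q0 rpred0.
  by rewrite mulrS -[z in z + _]scale1r qJ.
move=> d u' dd uu'; rewrite lt => lu'.
(* The valley ends at [l'], of rank [n]. A nonempty ascending part puts its bottom below rank [n],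
   so both terms lie in [J n]; otherwise it is a descending path and the formula for [theta] is
   exact. *)
have [u'0|u'0] := eqVneq u' [::].
  subst u'; have ld : last K d = l' := lu'.
  by rewrite cats0 /q; have := thV K d u dd; rewrite ld => -> //; rewrite subrr rpred0.
have low : sp K (d ++ u') \in J n.
  apply: (path_low spP); move: (rank_up uu'); rewrite lu' rl' => <-.
  by rewrite -addn1 leq_add2l lt0n size_eq0.
rewrite /q th0 ?tidealMr //; case: ifP => _; last by rewrite subr0 rpred0.
by rewrite sub0r rpredN low_idealZ.
Qed.

(** A dual basis is given by the classes of [up_gen l s] with l of rank [n]: the coordinate of x y,
    for y an ascending path from l, is x times the s-th coordinate of y in the span of ascending
    paths from l. *)
Lemma layer_projective : projective (subspace (left_regular JR)).
Proof.
have H l : exists p : (I -> A -> A) * (I -> A -> k), M l = n ->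
    (forall s, [/\ linear (p.1 s), forall x, x \in J n -> p.1 s x = 0 &
      forall (l' : flat M) x u, M l' = n -> path (@up E M) l' u -> x * sp l' [::] = x ->
        p.1 s (x * sp l' u) - (if l' == l then p.2 s (sp l u) *: x else 0) \in J n]) /\
    forall y, y \in up_from l -> \sum_s p.2 s y *: up_gen l s = y.
  have [rl|nl] := eqVneq (M l) n; last first.
    by exists (fun _ _ => 0, fun _ _ => 0) => e; rewrite e eqxx in nl.
  have [sg [sgL sgE]] := dual_family (@up_from_span l).
  have [th thP] := theta_exists rl sgL.
  by exists (th, sg).
have {H}[p pP] := choice H.
(* The choice of representative is harmless for flats of rank [n], since there the underlying map
   kills [J n]. *)
pose theta (i : flat M * I) (z : R) : R :=
  pi ((p i.1).1 i.2 (repr (z : Quotient.quot (J n)))).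
have thE (i : flat M * I) x : M i.1 = n -> theta i (pi x) = pi ((p i.1).1 i.2 x).
  move=> ri; have [/(_ i.2)[thl th0 _] _] := pP _ ri.
  apply/rpi_eqE; have := thl (-1) x (repr (pi x : Quotient.quot (J n))).
  rewrite !scaleN1r ![- _ + _]addrC => <-; rewrite th0 ?rpred0 //.
  by apply/rpi_eqE; rewrite /rpi reprK.
have thD (i : flat M * I) (x y : R) : M i.1 = n -> theta i (x + y) = theta i x + theta i y.
  move=> ri; have [/(_ i.2)[thl _ _] _] := pP _ ri.
  have [x' ->] := rpi_surj x; have [y' ->] := rpi_surj y.
  by rewrite -raddfD !thE // -raddfD; have := thl 1 x' y'; rewrite !scale1r => ->.
have th0 (i : flat M * I) : M i.1 = n -> theta i 0 = 0.
  by move=> ri; apply: (addrI (theta i 0)); rewrite -thD // !addr0.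
have thM (i : flat M * I) l (x : A) u :
    M i.1 = n -> M l = n -> path (@up E M) l u -> x * sp l [::] = x ->
    theta i (pi (x * sp l u)) = if l == i.1 then pi ((p i.1).2 i.2 (sp i.1 u) *: x) else 0.
  move=> ri rl lu xl; have [/(_ i.2)[_ _ thf] _] := pP _ ri.
  rewrite thE //; have /rpi_eqE -> := thf l x u rl lu xl.
  by case: ifP => // _; apply: raddf0.
apply: (@dual_basis_projective R (left_regular JR) (flat M * I)%type
  (fun i => M i.1 == n) (fun i => pi (up_gen i.1 i.2)) theta).
- move=> i /eqP ri; apply/asboolP; exists (up_gen i.1 i.2) => //.
  have := up_genM i.1 i.1 i.2; rewrite eqxx => <-.
  by rewrite tidealMr // idem_low // ri.
- move=> i /eqP ri a x y xJ yJ; rewrite thD //; congr (_ + _).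
  have [b ->] := rpi_surj a.
  move: x xJ; apply: layer_ind => [|x z Hx Hz|l x u rl lu xl].
  + by rewrite mulr0 th0 // mulr0.
  + by rewrite mulrDr !thD // Hx Hz mulrDr.
  have bxl : b * x * sp l [::] = b * x by rewrite -mulrA xl.
  rewrite -rmorphM mulrA (thM i l (b * x) u ri rl lu bxl) (thM i l x u ri rl lu xl).
  by case: ifP => _; rewrite ?mulr0 // -rmorphM scalerAr.
apply: layer_ind => [|x y Hx Hy|l x u rl lu xl].
- by rewrite big1 // => i /eqP ri; rewrite th0 // mul0r.
- rewrite -{2}Hx -{2}Hy -big_split; apply: eq_bigr => i /eqP ri /=.
  by rewrite thD // mulrDl.
have [_ sgE] := pP _ rl.
transitivity (\sum_(l' : flat M | M l' == n) \sum_(s : I)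
    theta (l', s) (pi (x * sp l u)) * pi (up_gen l' s)).
  by rewrite pair_big /=; apply: eq_big => [i|i _]; rewrite ?andbT.
rewrite (bigD1 l) ?rl //= [X in _ + X]big1 ?addr0 => [|l' /andP[/eqP rl' nl]]; last first.
  apply: big1 => s _; rewrite (thM (l', s) l x u rl' rl lu xl) /=.
  by rewrite eq_sym (negPf nl) mul0r.
have lu' : sp l u \in up_from l by apply: mem_gen_submod; exists u.
rewrite -{2}(sgE _ lu') mulr_sumr raddf_sum; apply: eq_bigr => s _.
rewrite (thM (l, s) l x u rl rl lu xl) /= eqxx -rmorphM.
by rewrite -scalerAl -scalerAr.
Qed.

End Layer.

Lemma schur_quasi_hereditary : quasi_hereditary A.
Proof.
split; first exact: finite_dimensional_span spP.
(* The rank of the whole ground set bounds all ranks of flats, so at its successor every idempotent,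
   hence 1, lies in the ideal. *)
exists (M setT).+1, (fun n => low_ideal sp n : tideal A); split.
- exact: low_ideal0.
- exact: low_ideal_full.
move=> n _; split; first exact: low_ideal_sub.
split; [|exact: low_radical|exact: layer_projective].
move=> _ /asboolP[x xn ->]; have [m [y [z [yz ->]]]] := low_idempotent xn.
exists m, (fun i => rpi (low_ideal sp n) (y i)), (fun i => rpi (low_ideal sp n) (z i)).
split=> [i|]; last by rewrite raddf_sum; apply: eq_bigr => i _; apply: rmorphM.
by have [yn zn] := yz i; split; apply/asboolP; [exists (y i) | exists (z i)].
Qed.

End Chain.

Theorem theorem7p2 (E : finType) (M : matroid E) (k : fieldType) :
  reedy_algebra (flat_idem k M) /\ quasi_hereditary (schur_over k M).
Proof.
have spP := schur_presentation M k; split.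
  exact: (schur_reedy spP).
exact: (schur_quasi_hereditary spP).
Qed.
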